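(* Let $\psi$ be a Ma-Minda function and let $0<r<1$. Assume that $\min_{|z|=r}|\psi(z)|=|\psi(z_1)|$ and $\max_{|z|=r}|\psi(z)|=|\psi(z_2)|$, where $z_1=re^{i\theta_1}$ and $z_2=re^{i\theta_2}$ for some $\theta_1,\theta_2\in[0,\pi]$. Let $f\in\mathcal{S}^*(\psi)$ and $|z_0|=r$. Then $$|\psi(z_1)|\left(\frac{-f_0(-r)}{r}\right)\le|f'(z_0)|\le\left(\frac{f_0(r)}{r}\right)|\psi(z_2)|,$$ where $$f_0(z)=z\exp\int_0^z\frac{\psi(t)-1}{t}\,dt.$$
   Context: $\mathbb{D}=\{z:|z|<1\}$. $\mathcal{A}$ is the class of analytic functions $f(z)=z+\sum_{k\ge2}a_kz^k$ in $\mathbb{D}$. $\prec$ denotes subordination. A Ma-Minda function is a function $\psi$ analytic and univalent in $\mathbb{D}$ with $\Re\psi(z)>0$, $\psi(0)=1$, $\psi'(0)>0$ and $\psi(\mathbb{D})$ symmetric about the real axis. $\mathcal{S}^*(\psi)=\{f\in\mathcal{A}:zf'(z)/f(z)\prec\psi(z)\}$. *)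

(* Defs.v *)
From Stdlib Require Export Reals.
From Coquelicot Require Export Coquelicot.

Open Scope R_scope.

Definition unit_disc (z : C) : Prop := Cmod z < 1.

(* Functions on the disc are total functions C -> C; only their values on the
   disc matter. *)
Definition analytic_on_disc (f : C -> C) : Prop :=
  forall z0 : C, unit_disc z0 ->
    exists (a : nat -> C) (rho : R), 0 < rho /\
      forall z : C, Cmod (z - z0) < rho ->
        is_pseries (K := C_AbsRing) (V := C_NormedModule) a (z - z0)%C (f z).

Definition univalent_on_disc (f : C -> C) : Prop :=
  forall z z' : C, unit_disc z -> unit_disc z' -> f z = f z' -> z = z'.

Definition class_A (f : C -> C) : Prop :=
  analytic_on_disc f /\
  exists a : nat -> C, a 0%nat = 0%C /\ a 1%nat = 1%C /\
    forall z : C, unit_disc z ->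
      is_pseries (K := C_AbsRing) (V := C_NormedModule) a z (f z).

Definition subordinate (F G : C -> C) : Prop :=
  analytic_on_disc F /\ analytic_on_disc G /\
  exists w : C -> C,
    analytic_on_disc w /\ w 0%C = 0%C /\
    (forall z : C, unit_disc z -> unit_disc (w z)) /\
    (forall z : C, unit_disc z -> F z = G (w z)).

Definition ma_minda (psi : C -> C) : Prop :=
  analytic_on_disc psi /\
  univalent_on_disc psi /\
  (forall z : C, unit_disc z -> 0 < Re (psi z)) /\
  psi 0%C = 1%C /\
  (Im (C_derive psi 0%C) = 0 /\ 0 < Re (C_derive psi 0%C)) /\
  (forall z : C, unit_disc z ->
     exists z' : C, unit_disc z' /\ psi z' = Cconj (psi z)).

(* z f'(z) / f(z), with its removable singularity at 0 filled in for f in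
   class_A.  At another zero of f the total division returns 0, but the
   quotient is unbounded near such a point, hence not analytic_on_disc. *)
Definition starlike_quotient (f : C -> C) (z : C) : C :=
  if Ceq_dec z 0 then 1%C else (z * C_derive f z / f z)%C.

Definition S_star (psi f : C -> C) : Prop :=
  class_A f /\ subordinate (starlike_quotient f) psi.

Definition Cexp (z : C) : C :=
  (exp (Re z) * cos (Im z), exp (Re z) * sin (Im z)).

(* Integral of g along the segment from 0 to z, parametrized by t = s z. *)
Definition C_segment_integral (g : C -> C) (z : C) : C :=
  RInt (V := C_R_CompleteNormedModule)
    (fun s : R => (z * g (RtoC s * z))%C) 0 1.

(* The value of the integrand at the removable singularity t = 0 does not
   affect the Riemann integral. *)
Definition f_0 (psi : C -> C) (z : C) : C :=
  (z * Cexp (C_segment_integral (fun t : C => (psi t - 1) / t) z))%C.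

(* An inequality between complex expressions asserts that both are real. *)
Definition Cle (u v : C) : Prop :=
  Im u = 0 /\ Im v = 0 /\ Re u <= Re v.

(* Main.v *)
Require Import Defs.
From Stdlib Require Import Lra Lia Classical ClassicalEpsilon List.

(** Write [f z = z * F z] and let [w] be the Schwarz function with
    [z f'(z) / f(z) = psi (w z)], so that [z F'(z) / F(z) = psi (w z) - 1] and
    [|f'(z)| = |psi (w z)| |f z| / |z|].  Since [|w z| <= |z|], the first factor
    lies between the extreme values of [|psi|] on [|z| = r], by the maximum
    principle for [psi] and for [1 / psi], which has no pole because
    [Re psi > 0].  What remains is the growth estimate
    [exp (H (-r)) <= |F z| <= exp (H r)] on [|z| = r], where [H x] is the
    integral of [(psi t - 1) / t] from [0] to [x]
    ([starlike_growth]); and [f_0 (+-r) = +-r exp (H (+-r))] ([f_0_real]).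

    For the growth estimate, let [M s] be the maximum of [ln |F|] on the circle [|z| = s], attained at [m].
    The derivative of [ln |F|] along the circle is [- Im (z F' / F)], which
    vanishes at [m]; so [psi (w m)] is real.  A univalent [psi] with
    real-symmetric image and [psi' 0 > 0] takes real values only on the real
    axis, and increases there ([ma_minda_real_axis]); therefore [w m] lies in
    [[-s, s]] and the radial derivative of [ln |F|] at [m], which is
    [(psi (w m) - 1) / s], is at most [(psi s - 1) / s = H' s].  Hence [M <= H].
    Adding a penalty [- e |z|] turns this into an argument about a single
    maximum on a closed disc ([radial_growth]), and the same lemma applied to
    [1 / F] and [- H (- s)] gives the lower bound.

    That [psi] commutes with conjugation ([conj_symmetric]) comes from the
    Schwarz lemma for [t = psi^-1 (conj (psi (conj z)))]: this map of the disc
    into itself fixes [0] with derivative [1] and is inverted by its conjugate,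
    so it is the identity.  Its regularity requires that an injective function
    be open and have a nonvanishing derivative, and both follow from the
    maximum principle applied to the inverse of [g - v] and of difference
    quotients of [g].

    Holomorphy is handled without contour integrals, through iterated
    difference quotients at a point ([jet], [smooth_at]).  This class contains
    convergent power series and is closed under all the operations used,
    including the removal of the zero of [g z - g c] by division ([slope]) and
    continuous inverse functions.  The maximum principle rests on the Taylor
    expansion of order two: the mean of [|g|^2] over the four points
    [c + t], [c - t], [c + i t], [c - i t] is at least
    [|g c|^2 + t^2 |g' c|^2 - O(t^3)] ([four_point_mean]). *)

(** * Iterated difference quotients *)

Definition continuous_at (g : C -> C) (c : C) : Prop :=
  forall e, 0 < e -> exists d, 0 < d /\
    forall z, Cmod (z - c) < d -> Cmod (g z - g c) < e.

(** [jet k g c] says that [g] can be divided [k] times by [z - c], each time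
    after subtracting its value at [c], with a bounded final quotient; that is,
    [g] has a Taylor expansion of order [k - 1] with remainder [O((z - c)^k)].
    The recursion on quotients makes every closure property below a short
    induction on [k]. *)
Fixpoint jet (k : nat) (g : C -> C) (c : C) : Prop :=
  match k with
  | O => exists B d, 0 < d /\ forall z, Cmod (z - c) < d -> Cmod (g z) <= B
  | S k' => exists q, jet k' q c /\ exists d, 0 < d /\
      forall z, Cmod (z - c) < d -> g z = (g c + (z - c) * q z)%C
  end.

Definition smooth_at (g : C -> C) (c : C) : Prop := forall k, jet k g c.

Lemma Cmod_sub_diag (c : C) : Cmod (c - c) = 0.
Proof. replace (c - c)%C with (RtoC 0) by ring. apply Cmod_0. Qed.

Lemma Cmod_sub_sym (a b : C) : Cmod (a - b) = Cmod (b - a).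
Proof. rewrite <- Cmod_opp. f_equal. ring. Qed.

Lemma Cmod_sub_ge (a b : C) : Cmod a - Cmod b <= Cmod (a - b).
Proof.
  pose proof (Cmod_triangle (a - b) b).
  replace (a - b + b)%C with a in H by ring. lra.
Qed.

Lemma Cmod_sub_triangle (a b c : C) : Cmod (a - c) <= Cmod (a - b) + Cmod (b - c).
Proof.
  replace (a - c)%C with ((a - b) + (b - c))%C by ring. apply Cmod_triangle.
Qed.

Lemma Csub_eq_0 (a b : C) : (a - b)%C = 0 -> a = b.
Proof. intros H. replace a with ((a - b) + b)%C by ring. rewrite H. ring. Qed.

Lemma Csub_neq_0 (a b : C) : a <> b -> (a - b)%C <> 0.
Proof. intros H E. apply H, Csub_eq_0, E. Qed.

Lemma jet_ext (k : nat) (g h : C -> C) (c : C) (d : R) :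
  0 < d -> (forall z, Cmod (z - c) < d -> g z = h z) -> jet k g c -> jet k h c.
Proof.
  intros Hd E. destruct k as [|k]; simpl.
  - intros [B [d' [Hd' HB]]]. exists B, (Rmin d d').
    split; [now apply Rmin_glb_lt|]. intros z Hz.
    pose proof (Rmin_l d d'). pose proof (Rmin_r d d').
    rewrite <- E by lra. apply HB. lra.
  - intros [q [Hq [d' [Hd' H]]]]. exists q. split; [exact Hq|].
    exists (Rmin d d'). split; [now apply Rmin_glb_lt|]. intros z Hz.
    pose proof (Rmin_l d d'). pose proof (Rmin_r d d').
    rewrite <- !E; [apply H; lra| |lra]. rewrite Cmod_sub_diag. lra.
Qed.

Lemma jet_pred (k : nat) (g : C -> C) (c : C) : jet (S k) g c -> jet k g c.
Proof.
  revert g. induction k as [|k IH]; intros g [q [Hq [d [Hd E]]]].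
  - destruct Hq as [B [d' [Hd' HB]]].
    exists (Cmod (g c) + d * B), (Rmin d d').
    split; [now apply Rmin_glb_lt|]. intros z Hz.
    pose proof (Rmin_l d d'). pose proof (Rmin_r d d').
    rewrite E by lra. eapply Rle_trans; [apply Cmod_triangle|].
    rewrite Cmod_mult. apply Rplus_le_compat_l.
    apply Rmult_le_compat; try apply Cmod_ge_0; [lra|apply HB; lra].
  - exists q. split; [apply IH, Hq|]. exists d. auto.
Qed.

Lemma jet_continuous (k : nat) (g : C -> C) (c : C) : jet (S k) g c -> continuous_at g c.
Proof.
  intros H. assert (H1 : jet 1 g c).
  { induction k as [|k IH]; auto. apply IH, jet_pred, H. }
  destruct H1 as [q [[B [d' [Hd' HB]]] [d [Hd E]]]]. intros e He.
  assert (HB0 : 0 <= B).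
  { eapply Rle_trans; [apply Cmod_ge_0|]. apply (HB c). rewrite Cmod_sub_diag; lra. }
  exists (Rmin (Rmin d d') (e / (B + 1))).
  assert (0 < e / (B + 1)) by (apply Rdiv_lt_0_compat; lra).
  split; [repeat apply Rmin_glb_lt; auto|]. intros z Hz.
  pose proof (Rmin_l d d'). pose proof (Rmin_r d d').
  pose proof (Rmin_l (Rmin d d') (e / (B + 1))).
  pose proof (Rmin_r (Rmin d d') (e / (B + 1))).
  rewrite E by lra. replace (g c + (z - c) * q z - g c)%C with ((z - c) * q z)%C by ring.
  rewrite Cmod_mult. apply Rle_lt_trans with (Cmod (z - c) * B).
  - apply Rmult_le_compat_l; [apply Cmod_ge_0|]. apply HB. lra.
  - apply Rle_lt_trans with (Cmod (z - c) * (B + 1)).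
    + pose proof (Cmod_ge_0 (z - c)). nra.
    + replace e with (e / (B + 1) * (B + 1)) by (field; lra).
      apply Rmult_lt_compat_r; lra.
Qed.

Lemma smooth_continuous (g : C -> C) (c : C) : smooth_at g c -> continuous_at g c.
Proof. intros H. exact (jet_continuous 0 g c (H 1%nat)). Qed.

Lemma jet_const (k : nat) (a c : C) : jet k (fun _ => a) c.
Proof.
  revert a. induction k as [|k IH]; intros a; simpl.
  - exists (Cmod a), 1. split; [lra|]. intros; lra.
  - exists (fun _ => 0%C). split; [apply IH|]. exists 1. split; [lra|]. intros; ring.
Qed.

Lemma jet_id (k : nat) (c : C) : jet k (fun z => z) c.
Proof.
  destruct k as [|k]; simpl.
  - exists (Cmod c + 1), 1. split; [lra|]. intros z Hz.
    pose proof (Cmod_sub_ge z c). lra.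
  - exists (fun _ => 1%C). split; [apply jet_const|]. exists 1. split; [lra|]. intros; ring.
Qed.

Lemma jet_plus (k : nat) (g h : C -> C) (c : C) :
  jet k g c -> jet k h c -> jet k (fun z => g z + h z)%C c.
Proof.
  revert g h. induction k as [|k IH]; intros g h.
  - intros [B [d [Hd H]]] [B' [d' [Hd' H']]]. exists (B + B'), (Rmin d d').
    split; [now apply Rmin_glb_lt|]. intros z Hz.
    pose proof (Rmin_l d d'). pose proof (Rmin_r d d').
    eapply Rle_trans; [apply Cmod_triangle|].
    apply Rplus_le_compat; [apply H|apply H']; lra.
  - intros [q [Hq [d [Hd H]]]] [q' [Hq' [d' [Hd' H']]]].
    exists (fun z => q z + q' z)%C. split; [now apply IH|]. exists (Rmin d d').
    split; [now apply Rmin_glb_lt|]. intros z Hz.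
    pose proof (Rmin_l d d'). pose proof (Rmin_r d d').
    rewrite H, H' by lra. ring.
Qed.

Lemma jet_mult (k : nat) (g h : C -> C) (c : C) :
  jet k g c -> jet k h c -> jet k (fun z => g z * h z)%C c.
Proof.
  revert g h. induction k as [|k IH]; intros g h.
  - intros [B [d [Hd H]]] [B' [d' [Hd' H']]]. exists (B * B'), (Rmin d d').
    split; [now apply Rmin_glb_lt|]. intros z Hz.
    pose proof (Rmin_l d d'). pose proof (Rmin_r d d').
    rewrite Cmod_mult.
    apply Rmult_le_compat; try apply Cmod_ge_0; [apply H|apply H']; lra.
  - intros Hg Hh. pose proof (jet_pred _ _ _ Hh) as Hh0.
    destruct Hg as [q [Hq [d [Hd H]]]]. destruct Hh as [q' [Hq' [d' [Hd' H']]]].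
    exists (fun z => q z * h z + g c * q' z)%C.
    split.
    { apply jet_plus; apply IH; auto. apply jet_const. }
    exists (Rmin d d').
    split; [now apply Rmin_glb_lt|]. intros z Hz.
    pose proof (Rmin_l d d'). pose proof (Rmin_r d d').
    rewrite (H z), (H' z) by lra. ring.
Qed.

Lemma continuous_away_from_0 (g : C -> C) (c : C) :
  continuous_at g c -> g c <> 0%C ->
  exists d, 0 < d /\ forall z, Cmod (z - c) < d -> Cmod (g c) / 2 <= Cmod (g z).
Proof.
  intros Hg H0. apply Cmod_gt_0 in H0.
  destruct (Hg (Cmod (g c) / 2)) as [d [Hd H]]; [lra|].
  exists d. split; [exact Hd|]. intros z Hz. specialize (H z Hz).
  rewrite Cmod_sub_sym in H. pose proof (Cmod_sub_ge (g c) (g z)). lra.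
Qed.

(** The quotient of [1 / g] is [- q / (g c * g)], where [q] is that of [g], so
    the order [k] for [1 / g] is needed to get order [k + 1]. *)
Lemma jet_inv (k : nat) (g : C -> C) (c : C) :
  continuous_at g c -> g c <> 0%C -> jet k g c -> jet k (fun z => / g z)%C c.
Proof.
  intros Hg H0. destruct (continuous_away_from_0 g c Hg H0) as [d [Hd H]].
  apply Cmod_gt_0 in H0 as H1.
  assert (Hnz : forall z, Cmod (z - c) < d -> g z <> 0%C).
  { intros z Hz. apply Cmod_gt_0. specialize (H z Hz). lra. }
  induction k as [|k IH].
  - intros _. exists (/ (Cmod (g c) / 2)), d. split; [exact Hd|]. intros z Hz.
    rewrite Cmod_inv by auto. apply Rinv_le_contravar; [lra|]. auto.
  - intros Hk. pose proof (IH (jet_pred _ _ _ Hk)) as Hi.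
    destruct Hk as [q [Hq [d' [Hd' E]]]].
    exists (fun z => (- / g c) * (q z * / g z))%C. split.
    { apply jet_mult; [apply jet_const|]. now apply jet_mult. }
    exists (Rmin d d').
    split; [now apply Rmin_glb_lt|]. intros z Hz.
    pose proof (Rmin_l d d'). pose proof (Rmin_r d d').
    assert (Hz' : g z <> 0%C) by (apply Hnz; lra).
    assert (E' : ((z - c) * q z = g z - g c)%C) by (rewrite (E z) by lra; ring).
    replace (/ g c + (z - c) * (- / g c * (q z * / g z)))%C
      with (/ g c - / g c * ((z - c) * q z) * / g z)%C by ring.
    rewrite E'. field. split; auto.
Qed.

Lemma jet_comp (k : nat) (g t : C -> C) (c : C) :
  continuous_at t c -> jet k g (t c) -> jet k t c -> jet k (fun z => g (t z)) c.
Proof.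
  intros Ht. revert g. induction k as [|k IH]; intros g Hg Hk.
  - destruct Hg as [B [d [Hd H]]]. destruct (Ht d Hd) as [d' [Hd' H']].
    exists B, d'. auto.
  - pose proof (jet_pred _ _ _ Hk) as Hk0.
    destruct Hg as [q [Hq [d [Hd H]]]]. destruct Hk as [p [Hp [d1 [Hd1 H1]]]].
    destruct (Ht d Hd) as [d' [Hd' H']].
    exists (fun z => p z * q (t z))%C. split.
    { apply jet_mult; auto. }
    exists (Rmin d1 d').
    split; [now apply Rmin_glb_lt|]. intros z Hz.
    pose proof (Rmin_l d1 d'). pose proof (Rmin_r d1 d').
    rewrite H by (apply H'; lra). rewrite (H1 z) at 1 by lra. ring.
Qed.

Lemma Cconj_conj (z : C) : Cconj (Cconj z) = z.
Proof. destruct z as [x y]. unfold Cconj; simpl. f_equal. ring. Qed.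

Lemma Cconj_plus (a b : C) : Cconj (a + b) = (Cconj a + Cconj b)%C.
Proof. destruct a, b. unfold Cconj, Cplus; simpl. f_equal. ring. Qed.

Lemma Cconj_minus (a b : C) : Cconj (a - b) = (Cconj a - Cconj b)%C.
Proof. destruct a, b. unfold Cconj, Cminus, Cplus, Copp; simpl. f_equal. ring. Qed.

Lemma Cconj_mult (a b : C) : Cconj (a * b) = (Cconj a * Cconj b)%C.
Proof. destruct a, b. unfold Cconj, Cmult; simpl. f_equal; ring. Qed.

Lemma Cmod_conj_sub (z c : C) : Cmod (Cconj z - c) = Cmod (z - Cconj c).
Proof. rewrite <- (Cmod_conj (z - Cconj c)), Cconj_minus, Cconj_conj. reflexivity. Qed.

Lemma jet_conj (k : nat) (g : C -> C) (c : C) :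
  jet k g (Cconj c) -> jet k (fun z => Cconj (g (Cconj z))) c.
Proof.
  revert g. induction k as [|k IH]; intros g.
  - intros [B [d [Hd H]]]. exists B, d. split; [exact Hd|]. intros z Hz.
    rewrite Cmod_conj. apply H. rewrite Cmod_conj_sub, Cconj_conj. exact Hz.
  - intros [q [Hq [d [Hd H]]]]. exists (fun z => Cconj (q (Cconj z))).
    split; [now apply IH|]. exists d. split; [exact Hd|]. intros z Hz.
    rewrite H by (rewrite Cmod_conj_sub, Cconj_conj; exact Hz).
    rewrite Cconj_plus, Cconj_mult, Cconj_minus, !Cconj_conj. reflexivity.
Qed.

Lemma smooth_const (a c : C) : smooth_at (fun _ => a) c.
Proof. intros k. apply jet_const. Qed.
Lemma smooth_id (c : C) : smooth_at (fun z => z) c.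
Proof. intros k. apply jet_id. Qed.
Lemma smooth_ext (g h : C -> C) (c : C) (d : R) :
  0 < d -> (forall z, Cmod (z - c) < d -> g z = h z) -> smooth_at g c -> smooth_at h c.
Proof. intros Hd E H k. exact (jet_ext k g h c d Hd E (H k)). Qed.
Lemma smooth_plus (g h : C -> C) (c : C) :
  smooth_at g c -> smooth_at h c -> smooth_at (fun z => g z + h z)%C c.
Proof. intros Hg Hh k. now apply jet_plus. Qed.
Lemma smooth_mult (g h : C -> C) (c : C) :
  smooth_at g c -> smooth_at h c -> smooth_at (fun z => g z * h z)%C c.
Proof. intros Hg Hh k. now apply jet_mult. Qed.
Lemma smooth_inv (g : C -> C) (c : C) :
  smooth_at g c -> g c <> 0%C -> smooth_at (fun z => / g z)%C c.
Proof. intros Hg H0 k. apply jet_inv; auto. now apply smooth_continuous. Qed.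
Lemma smooth_comp (g t : C -> C) (c : C) :
  smooth_at g (t c) -> smooth_at t c -> smooth_at (fun z => g (t z)) c.
Proof. intros Hg Ht k. apply jet_comp; auto. now apply smooth_continuous. Qed.
Lemma smooth_conj (g : C -> C) (c : C) :
  smooth_at g (Cconj c) -> smooth_at (fun z => Cconj (g (Cconj z))) c.
Proof. intros H k. now apply jet_conj. Qed.
Lemma smooth_minus_const (g : C -> C) (a c : C) :
  smooth_at g c -> smooth_at (fun z => g z - a)%C c.
Proof. intros H. apply (smooth_plus g (fun _ => - a)%C); auto. apply smooth_const. Qed.

(** * Difference quotients and the complex derivative *)

Lemma C_derive_of_slope (g q : C -> C) (c : C) (d : R) :
  0 < d -> (forall z, Cmod (z - c) < d -> g z = (g c + (z - c) * q z)%C) ->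
  continuous_at q c -> C_derive g c = q c.
Proof.
  intros Hd E Hq. apply is_C_lim_unique.
  intros P [e He].
  destruct (Hq e (cond_pos e)) as [d' [Hd' H]].
  assert (Hm : 0 < Rmin d d') by now apply Rmin_glb_lt.
  assert (H2 : 0 < Rmin d d' / sqrt 2).
  { apply Rdiv_lt_0_compat; auto. apply Rlt_sqrt2_0. }
  exists (mkposreal _ H2). intros z Hz Hne.
  apply He. apply C_NormedModule_mixin_compat1. change (Cmod ((g z - g c) / (z - c) - q c) < e).
  assert (Hzc : Cmod (z - c) < Rmin d d').
  { apply C_NormedModule_mixin_compat2 in Hz. simpl in Hz.
    replace (sqrt 2 * (Rmin d d' / sqrt 2)) with (Rmin d d') in Hz.
    exact Hz. field. apply Rgt_not_eq, Rlt_sqrt2_0. }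
  pose proof (Rmin_l d d'). pose proof (Rmin_r d d').
  rewrite (E z) by lra.
  replace ((g c + (z - c) * q z - g c) / (z - c))%C with (q z).
  - apply H. lra.
  - field. now apply Csub_neq_0.
Qed.

(** The value [C_derive g c] at [c] is the one that makes the quotient
    continuous when [g] is smooth. *)
Definition slope (g : C -> C) (c z : C) : C :=
  if Ceq_dec z c then C_derive g c else ((g z - g c) / (z - c))%C.

Lemma slope_eq (g : C -> C) (c z : C) : g z = (g c + (z - c) * slope g c z)%C.
Proof.
  unfold slope. destruct (Ceq_dec z c) as [->|Hn]; [ring|].
  field. now apply Csub_neq_0.
Qed.

Lemma slope_diag (g : C -> C) (c : C) : slope g c c = C_derive g c.
Proof. unfold slope. destruct (Ceq_dec c c); congruence. Qed.

Lemma slope_off (g : C -> C) (c z : C) : z <> c -> slope g c z = ((g z - g c) / (z - c))%C.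
Proof. intros H. unfold slope. destruct (Ceq_dec z c); congruence. Qed.

(** Removable singularity: at [c] the first quotient in a jet of order [k + 2]
    agrees with the slope, by continuity also at [c] itself. *)
Lemma smooth_slope (g : C -> C) (c z : C) :
  smooth_at g c -> smooth_at g z -> smooth_at (slope g c) z.
Proof.
  intros Hc Hz. destruct (Ceq_dec z c) as [->|Hne].
  - intros k. destruct (Hc (S (S k))) as [q [Hq [d [Hd E]]]].
    apply (jet_ext k q _ c d Hd); [|now apply jet_pred].
    intros y Hy. unfold slope. destruct (Ceq_dec y c) as [->|Hn].
    + symmetry. apply (C_derive_of_slope g q c d); auto. now apply (jet_continuous k).
    + rewrite (E y Hy). field. now apply Csub_neq_0.
  - apply (smooth_ext (fun y => (g y - g c) * / (y - c))%C _ z (Cmod (z - c))).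
    + apply Cmod_gt_0. now apply Csub_neq_0.
    + intros y Hy. rewrite slope_off; [reflexivity|].
      intros ->. rewrite Cmod_sub_sym in Hy. lra.
    + apply smooth_mult; [now apply smooth_minus_const|].
      apply smooth_inv; [apply smooth_minus_const, smooth_id|now apply Csub_neq_0].
Qed.

(** If [g (t z) = p z], then the quotient of [t] at [c] is that of [p] divided
    by that of [g] taken at [t z].  Thus an order [k] expansion of [t] yields one
    of order [k + 1], and mere continuity of [t] starts the induction. *)
Lemma smooth_inverse_function (g p t : C -> C) (c : C) (d : R) :
  continuous_at t c -> smooth_at g (t c) -> smooth_at p c ->
  C_derive g (t c) <> 0%C ->
  0 < d -> (forall z, Cmod (z - c) < d -> g (t z) = p z) ->
  smooth_at t c.
Proof.
  intros Ht Hg Hp Hne Hd E k.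
  pose (q := slope g (t c)). pose (s := slope p c).
  assert (Hq : smooth_at q (t c)) by now apply smooth_slope.
  assert (Hqt : continuous_at (fun z => q (t z)) c).
  { intros e He. destruct (smooth_continuous _ _ Hq e He) as [d1 [Hd1 H1]].
    destruct (Ht d1 Hd1) as [d2 [Hd2 H2]]. exists d2. auto. }
  assert (Hq0 : q (t c) <> 0%C) by (unfold q; now rewrite slope_diag).
  induction k as [|k IH].
  - destruct (Ht 1 Rlt_0_1) as [d1 [Hd1 H1]]. exists (Cmod (t c) + 1), d1.
    split; [exact Hd1|]. intros z Hz. specialize (H1 z Hz).
    pose proof (Cmod_sub_ge (t z) (t c)). lra.
  - exists (fun z => s z * / q (t z))%C. split.
    { apply jet_mult; [now apply smooth_slope|].
      apply (jet_inv k (fun z => q (t z))); auto. now apply jet_comp. }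
    destruct (continuous_away_from_0 _ c Hqt Hq0) as [d1 [Hd1 H1]].
    exists (Rmin d d1). split; [now apply Rmin_glb_lt|]. intros z Hz.
    pose proof (Rmin_l d d1). pose proof (Rmin_r d d1).
    assert (Hqz : q (t z) <> 0%C).
    { apply Cmod_gt_0. apply Cmod_gt_0 in Hq0. specialize (H1 z ltac:(lra)). lra. }
    assert (A : ((t z - t c) * q (t z) = (z - c) * s z)%C).
    { pose proof (slope_eq g (t c) (t z)) as A1. pose proof (slope_eq p c z) as A2.
      fold q in A1. fold s in A2.
      rewrite E in A1 by lra. rewrite (E c) in A1 by (rewrite Cmod_sub_diag; lra).
      rewrite A2 in A1.
      replace ((t z - t c) * q (t z))%C with ((p c + (t z - t c) * q (t z)) - p c)%C by ring.
      rewrite <- A1. ring. }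
    replace (t c + (z - c) * (s z * / q (t z)))%C
      with (t c + ((z - c) * s z) * / q (t z))%C by ring.
    rewrite <- A. field. exact Hqz.
Qed.

(** * Power series *)

Notation is_Cpseries := (is_pseries (K := C_AbsRing) (V := C_NormedModule)).

Lemma Cmod_pow_n (x : C) (k : nat) : Cmod (pow_n (K := C_AbsRing) x k) = Cmod x ^ k.
Proof.
  induction k as [|k IH]; [exact Cmod_1|].
  change (Cmod (x * pow_n (K := C_AbsRing) x k) = Cmod x ^ S k).
  rewrite Cmod_mult, IH. reflexivity.
Qed.

Lemma is_Cpseries_partial_sums (a : nat -> C) (x l : C) (e : R) :
  is_Cpseries a x l -> 0 < e ->
  exists N, forall n, (N <= n)%nat ->
    Cmod (sum_n (G := C_NormedModule)
            (fun k => scal (K := C_AbsRing) (V := C_NormedModule) (pow_n x k) (a k)) n - l) < e.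
Proof.
  intros H He.
  assert (H2 : 0 < e / sqrt 2) by (apply Rdiv_lt_0_compat; [lra|apply Rlt_sqrt2_0]).
  destruct (H (fun y => Cmod (y - l) < e)) as [N HN].
  - exists (mkposreal _ H2). intros y Hy.
    apply C_NormedModule_mixin_compat2 in Hy. simpl in Hy.
    replace (sqrt 2 * (e / sqrt 2)) with e in Hy; [exact Hy|].
    field. apply Rgt_not_eq, Rlt_sqrt2_0.
  - exists N. exact HN.
Qed.

Lemma finite_bound (u : nat -> R) (N : nat) :
  exists B, forall n, (n <= N)%nat -> u n <= B.
Proof.
  induction N as [|N [B HB]].
  - exists (u 0%nat). intros n Hn. replace n with 0%nat by lia. lra.
  - exists (Rmax B (u (S N))). intros n Hn.
    destruct (Nat.eq_dec n (S N)) as [->|]; [apply Rmax_r|].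
    eapply Rle_trans; [apply HB; lia|apply Rmax_l].
Qed.

Lemma is_Cpseries_terms_bounded (a : nat -> C) (x l : C) :
  is_Cpseries a x l -> exists B, 0 <= B /\ forall n, Cmod x ^ n * Cmod (a n) <= B.
Proof.
  intros H. destruct (is_Cpseries_partial_sums a x l 1 H Rlt_0_1) as [N HN].
  destruct (finite_bound (fun n => Cmod x ^ n * Cmod (a n)) N) as [B HB].
  exists (Rmax B 2). split; [pose proof (Rmax_r B 2); lra|].
  intros n. destruct (Nat.le_gt_cases n N) as [Hn|Hn].
  - eapply Rle_trans; [now apply HB|apply Rmax_l].
  - eapply Rle_trans; [|apply Rmax_r]. destruct n as [|n]; [lia|].
    pose proof (HN n ltac:(lia)) as H1. pose proof (HN (S n) ltac:(lia)) as H2.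
    rewrite sum_Sn in H2.
    set (s := sum_n _ _) in *.
    rewrite <- Cmod_pow_n, <- Cmod_mult.
    set (t := (pow_n (K := C_AbsRing) x (S n) * a (S n))%C).
    change (Cmod ((s + t)%C - l) < 1) in H2. change (Cmod (s - l) < 1) in H1.
    replace t with (((s + t) - l) - (s - l))%C by ring.
    pose proof (Cmod_triangle ((s + t) - l) (- (s - l))) as H3.
    rewrite Cmod_opp in H3. unfold Cminus at 1. lra.
Qed.

(** Convergence at distance [rho / 2] bounds the terms there; closer to [c] than
    [rho / 4] the series is dominated by a geometric one of ratio [1 / 2]. *)
Lemma pseries_locally_bounded (a : nat -> C) (g : C -> C) (c : C) (rho : R) :
  0 < rho -> (forall z, Cmod (z - c) < rho -> is_Cpseries a (z - c)%C (g z)) ->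
  jet 0 g c.
Proof.
  intros Hr H.
  assert (Hx : Cmod (c + RtoC (rho / 2) - c) = rho / 2).
  { replace (c + RtoC (rho / 2) - c)%C with (RtoC (rho / 2)) by ring.
    rewrite Cmod_R, Rabs_pos_eq; lra. }
  destruct (is_Cpseries_terms_bounded _ _ _ (H (c + RtoC (rho / 2))%C ltac:(lra))) as [B [HB0 HB]].
  rewrite Hx in HB. exists (2 * B + 1), (rho / 4). split; [lra|]. intros z Hz.
  destruct (is_Cpseries_partial_sums _ _ _ 1 (H z ltac:(lra)) Rlt_0_1) as [N HN].
  specialize (HN N (Nat.le_refl N)).
  set (S := sum_n _) in *.
  assert (HS : forall n, Cmod (S n) <= B * (2 - (/ 2) ^ n)).
  { assert (T : forall n, Cmod (pow_n (K := C_AbsRing) (z - c)%C n * a n) <= B * (/ 2) ^ n).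
    { intros n. rewrite Cmod_mult, Cmod_pow_n.
      apply Rle_trans with ((/ 2) ^ n * ((rho / 2) ^ n * Cmod (a n))).
      - rewrite <- Rmult_assoc, <- Rpow_mult_distr.
        apply Rmult_le_compat_r; [apply Cmod_ge_0|]. apply pow_incr.
        split; [apply Cmod_ge_0|]. lra.
      - rewrite Rmult_comm. apply Rmult_le_compat_r; [apply pow_le; lra|]. apply HB. }
    intros n. induction n as [|n IH].
    - unfold S. rewrite sum_O. specialize (T 0%nat). simpl in *.
      eapply Rle_trans; [exact T|]. lra.
    - unfold S. rewrite sum_Sn. fold S.
      eapply Rle_trans; [apply Cmod_triangle|].
      specialize (T (Datatypes.S n)).
      eapply Rle_trans; [apply Rplus_le_compat; [exact IH|exact T]|]. simpl. lra. }
  specialize (HS N).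
  assert (0 <= (/ 2) ^ N) by (apply pow_le; lra).
  pose proof (Cmod_sub_ge (g z) (S N)) as H1. rewrite Cmod_sub_sym in H1.
  assert (0 <= B * (/ 2) ^ N) by (apply Rmult_le_pos; lra). lra.
Qed.

(** The difference quotient of a power series is the shifted power series, which
    converges on the same disc; iterating this gives all jets. *)
Lemma pseries_slope (a : nat -> C) (g : C -> C) (c : C) (rho : R) :
  0 < rho -> (forall z, Cmod (z - c) < rho -> is_Cpseries a (z - c)%C (g z)) ->
  g c = a 0%nat /\
  exists q, q c = a 1%nat /\
    (forall z, g z = g c + (z - c) * q z)%C /\
    forall z, Cmod (z - c) < rho -> is_Cpseries (PS_decr_1 a) (z - c)%C (q z).
Proof.
  intros Hr H.
  assert (Z : (c - c)%C = @zero C_AbsRing) by (change ((c - c)%C = RtoC 0); ring).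
  assert (H0 : g c = a 0%nat).
  { specialize (H c). rewrite Cmod_sub_diag in H. specialize (H Hr). rewrite Z in H.
    apply (filterlim_locally_unique (V := C_NormedModule) _ _ _ H
             (is_pseries_0 (K := C_AbsRing) (V := C_NormedModule) a)). }
  split; [exact H0|].
  exists (fun z => if Ceq_dec z c then a 1%nat else ((g z - g c) / (z - c))%C).
  split; [|split].
  - destruct (Ceq_dec c c); congruence.
  - intros z. destruct (Ceq_dec z c) as [->|Hne]; [ring|]. field. now apply Csub_neq_0.
  - intros z Hz. destruct (Ceq_dec z c) as [->|Hne].
    + rewrite Z. apply (is_pseries_0 (K := C_AbsRing) (V := C_NormedModule)).
    + replace ((g z - g c) / (z - c))%C with (/ (z - c) * (g z + - a 0%nat))%C
        by (rewrite <- H0; field; now apply Csub_neq_0).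
      apply (is_pseries_decr_1 (K := C_AbsRing) (V := C_NormedModule) a
               (z - c)%C (/ (z - c))%C (g z)); [|now apply H].
      change ((/ (z - c) * (z - c))%C = 1%C). field. now apply Csub_neq_0.
Qed.

Lemma pseries_smooth (a : nat -> C) (g : C -> C) (c : C) (rho : R) :
  0 < rho -> (forall z, Cmod (z - c) < rho -> is_Cpseries a (z - c)%C (g z)) ->
  smooth_at g c.
Proof.
  intros Hr H k. revert a g H. induction k as [|k IH]; intros a g H.
  - now apply (pseries_locally_bounded a g c rho).
  - destruct (pseries_slope a g c rho Hr H) as [_ [q [_ [E Hq]]]].
    exists q. split; [now apply (IH (PS_decr_1 a))|]. exists rho. auto.
Qed.

Lemma pseries_derive (a : nat -> C) (g : C -> C) (c : C) (rho : R) :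
  0 < rho -> (forall z, Cmod (z - c) < rho -> is_Cpseries a (z - c)%C (g z)) ->
  C_derive g c = a 1%nat.
Proof.
  intros Hr H. destruct (pseries_slope a g c rho Hr H) as [_ [q [Hqc [E Hq]]]].
  rewrite <- Hqc. apply (C_derive_of_slope g q c rho); auto.
  now apply smooth_continuous, (pseries_smooth (PS_decr_1 a) q c rho).
Qed.

Lemma analytic_smooth (f : C -> C) (z : C) :
  analytic_on_disc f -> unit_disc z -> smooth_at f z.
Proof.
  intros H Hz. destruct (H z Hz) as [a [rho [Hr Ha]]]. exact (pseries_smooth a f z rho Hr Ha).
Qed.

(** * Extreme values on compact sets *)

Lemma list_argmax {A : Type} (u : A -> R) (l : list A) :
  l <> nil -> exists x, In x l /\ forall y, In y l -> u y <= u x.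
Proof.
  induction l as [|x l IH]; [congruence|]. intros _.
  destruct l as [|y l'].
  - exists x. split; [now left|]. intros y [->|[]]. lra.
  - destruct IH as [m [Hm HM]]; [congruence|].
    destruct (Rle_lt_dec (u m) (u x)) as [Hc|Hc].
    + exists x. split; [now left|]. intros z [->|Hz]; [lra|]. specialize (HM z Hz). lra.
    + exists m. split; [now right|]. intros z [->|Hz]; [lra|]. auto.
Qed.

(** Upper semicontinuity on a closed bounded set is enough.  If there were no
    maximum, each point would have a neighbourhood on which [F] stays below
    the value at some chosen point of the set; among the finitely many
    chosen points of a finite subcover, the one with the largest value would be
    beaten by another. *)
Lemma compact_max (P : C -> Prop) (F : C -> R) (B : R) (p : C) :
  P p -> (forall z, P z -> Cmod z <= B) ->
  (forall z, ~ P z -> exists d, 0 < d /\ forall y, Cmod (y - z) < d -> ~ P y) ->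
  (forall z, P z -> forall e, 0 < e ->
     exists d, 0 < d /\ forall y, P y -> Cmod (y - z) < d -> F y < F z + e) ->
  exists m, P m /\ forall z, P z -> F z <= F m.
Proof.
  intros Hp HB Hcl HF. apply NNPP. intros Hno.
  assert (D : forall t : R * (R * unit), exists dm : posreal * C,
    P (snd dm) /\
    forall y : C, P y -> Cmod (y - (fst t, fst (snd t))) < fst dm -> F y < F (snd dm)).
  { intros [x [y []]]. simpl. destruct (classic (P (x, y))) as [HP|HP].
    - destruct (classic (exists m, P m /\ F (x, y) < F m)) as [[m [Hm Hlt]]|Hn].
      + destruct (HF _ HP (F m - F (x, y)) ltac:(lra)) as [d [Hd H]].
        exists (mkposreal d Hd, m). split; [exact Hm|]. intros z Hz Hzd.
        specialize (H z Hz Hzd). simpl. lra.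
      + exfalso. apply Hno. exists (x, y). split; [exact HP|]. intros z Hz.
        destruct (Rle_lt_dec (F z) (F (x, y))); [assumption|]. exfalso. apply Hn. now exists z.
    - destruct (Hcl _ HP) as [d [Hd H]]. exists (mkposreal d Hd, p). split; [exact Hp|].
      intros z Hz Hzd. exfalso. exact (H z Hzd Hz). }
  pose (D' := fun t => proj1_sig (constructive_indefinite_description _ (D t))).
  assert (HD : forall t, P (snd (D' t)) /\
    forall y : C, P y -> Cmod (y - (fst t, fst (snd t))) < fst (D' t) -> F y < F (snd (D' t))).
  { intros t. exact (proj2_sig (constructive_indefinite_description _ (D t))). }
  assert (half_pos : forall d : posreal, 0 < d / 2) by (intros [d Hd]; simpl; lra).
  apply (compactness_list 2 (-B, (-B, tt)) (B, (B, tt))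
           (fun t => mkposreal _ (half_pos (fst (D' t))))).
  intros [l Hl].
  assert (Cover : forall y, P y -> exists t, In t l /\ F y < F (snd (D' t))).
  { intros [x y] Hy. pose proof (HB _ Hy) as Hb. pose proof (Rmax_Cmod (x, y)) as Hm. simpl in Hm.
    pose proof (Rmax_l (Rabs x) (Rabs y)). pose proof (Rmax_r (Rabs x) (Rabs y)).
    assert (Hx1 : -B <= x <= B) by (apply Rabs_le_between; lra).
    assert (Hx2 : -B <= y <= B) by (apply Rabs_le_between; lra).
    destruct (Hl (x, (y, tt))) as [[t1 [t2 []]] [Ht [_ Hcl']]].
    { simpl. tauto. }
    exists (t1, (t2, tt)). split; [exact Ht|]. apply HD; [exact Hy|].
    simpl in Hcl'. destruct Hcl' as [H1 [H2 _]]. simpl.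
    replace ((x, y) - (t1, t2))%C with (RtoC (x - t1) + Ci * RtoC (y - t2))%C
      by (unfold RtoC, Ci, Cmult, Cminus, Copp, Cplus; simpl; f_equal; ring).
    eapply Rle_lt_trans; [apply Cmod_triangle|].
    rewrite Cmod_mult, Cmod_Ci, !Cmod_R. lra. }
  assert (Hnil : l <> nil).
  { intros ->. destruct (Cover p Hp) as [t [[] _]]. }
  destruct (list_argmax (fun t => F (snd (D' t))) l Hnil) as [m [Hm HM]].
  destruct (Cover _ (proj1 (HD m))) as [t [Ht Hlt]].
  specialize (HM t Ht). simpl in HM. lra.
Qed.

(** * Maximum and minimum principles *)

Lemma Cmod_sqr_add_ge (A E : C) : Cmod A ^ 2 - 2 * Cmod A * Cmod E <= Cmod (A + E) ^ 2.
Proof.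
  pose proof (Cmod_sub_ge A (- E)) as H. rewrite Cmod_opp in H.
  replace (A - - E)%C with (A + E)%C in H by ring.
  pose proof (Cmod_ge_0 (A + E)). pose proof (Cmod_ge_0 A). pose proof (Cmod_ge_0 E).
  destruct (Rle_lt_dec (Cmod E) (Cmod A)); nra.
Qed.

Lemma four_directions (P : C -> Prop) (t : R) :
  0 < t -> (forall x, Cmod x = t -> P x) ->
  P (RtoC t) /\ P (RtoC (- t)) /\ P (Ci * RtoC t)%C /\ P (Ci * RtoC (- t))%C.
Proof.
  intros Ht HP.
  assert (T1 : Cmod (RtoC t) = t) by (rewrite Cmod_R, Rabs_pos_eq; lra).
  assert (T2 : Cmod (RtoC (- t)) = t) by (rewrite Cmod_R, Rabs_Ropp, Rabs_pos_eq; lra).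
  repeat split; apply HP; rewrite ?Cmod_mult, ?Cmod_Ci, ?T1, ?T2; ring.
Qed.

Lemma quadratic_beats_cubic (K b d : R) :
  0 < b -> 0 < d -> exists t, 0 < t < d /\ K * t ^ 3 < b * t ^ 2.
Proof.
  intros Hb Hd. pose proof (Rabs_pos K). pose proof (Rle_abs K).
  pose (t := Rmin (d / 2) (b / (2 * (Rabs K + 1)))).
  assert (Ht : 0 < t) by (apply Rmin_glb_lt; [lra|apply Rdiv_lt_0_compat; lra]).
  assert (t <= d / 2) by apply Rmin_l.
  assert (HtK : t * (Rabs K + 1) <= b / 2).
  { apply Rle_trans with (b / (2 * (Rabs K + 1)) * (Rabs K + 1)).
    - apply Rmult_le_compat_r; [lra|apply Rmin_r].
    - right. field. lra. }
  exists t. split; [lra|]. assert (0 < t ^ 2) by (apply pow_lt; lra).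
  replace (K * t ^ 3) with (K * t * t ^ 2) by ring. apply Rmult_lt_compat_r; nra.
Qed.

(** In [|a0 + a1 x + a2 x^2|^2] the cross terms are real parts of multiples of
    [x], [x^2] and [x |x|^2].  Each of them cancels in the sum over
    [x = t, -t, i t, -i t]. *)
Lemma four_point_mean (g : C -> C) (c : C) :
  smooth_at g c ->
  exists K d, 0 < d /\ forall t, 0 < t < d ->
    4 * Cmod (g c) ^ 2 + 4 * t ^ 2 * Cmod (C_derive g c) ^ 2 - K * t ^ 3 <=
    Cmod (g (c + RtoC t)%C) ^ 2 + Cmod (g (c + RtoC (- t))%C) ^ 2 +
    Cmod (g (c + Ci * RtoC t)%C) ^ 2 + Cmod (g (c + Ci * RtoC (- t))%C) ^ 2.
Proof.
  intros Hg. pose (q1 := slope g c). pose (q2 := slope q1 c). pose (q3 := slope q2 c).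
  assert (S1 : smooth_at q1 c) by now apply smooth_slope.
  assert (S2 : smooth_at q2 c) by now apply smooth_slope.
  assert (S3 : smooth_at q3 c) by now apply smooth_slope.
  destruct (S3 0%nat) as [B [d [Hd HB]]].
  set (a0 := g c). set (a1 := C_derive g c). set (a2 := C_derive q1 c).
  set (M := Cmod a0 + Cmod a1 + Cmod a2).
  pose (A := fun x : C => (a0 + x * a1 + x * x * a2)%C).
  assert (HM : 0 <= M) by (unfold M; pose proof (Cmod_ge_0 a0);
    pose proof (Cmod_ge_0 a1); pose proof (Cmod_ge_0 a2); lra).
  exists (8 * M * B), (Rmin d 1). split; [apply Rmin_glb_lt; lra|]. intros t Ht.
  pose proof (Rmin_l d 1). pose proof (Rmin_r d 1).
  assert (P : forall x, Cmod x = t -> Cmod (A x) ^ 2 - 2 * M * B * t ^ 3 <= Cmod (g (c + x)%C) ^ 2).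
  { intros x Hx.
    assert (E : g (c + x)%C = (A x + x * x * x * q3 (c + x)%C)%C).
    { unfold A, a0, a1, a2. rewrite (slope_eq g c (c + x)%C). fold q1.
      rewrite (slope_eq q1 c (c + x)%C). fold q2.
      rewrite (slope_eq q2 c (c + x)%C). fold q3.
      unfold q1 at 1. unfold q2 at 1. rewrite !slope_diag. ring. }
    rewrite E. eapply Rle_trans; [|apply Cmod_sqr_add_ge].
    assert (H3 : Cmod (x * x * x * q3 (c + x)%C) <= t ^ 3 * B).
    { rewrite !Cmod_mult, Hx. replace (t * t * t) with (t ^ 3) by ring.
      apply Rmult_le_compat_l; [apply pow_le; lra|]. apply HB.
      replace (c + x - c)%C with x by ring. lra. }
    assert (H4 : Cmod (A x) <= M).
    { unfold A, M. eapply Rle_trans; [apply Cmod_triangle|].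
      pose proof (Cmod_triangle a0 (x * a1)).
      rewrite Cmod_mult, Hx in H1. rewrite !Cmod_mult, Hx.
      assert (t * Cmod a1 <= 1 * Cmod a1) by (apply Rmult_le_compat_r; [apply Cmod_ge_0|lra]).
      assert (t * t * Cmod a2 <= 1 * Cmod a2) by (apply Rmult_le_compat_r; [apply Cmod_ge_0|nra]).
      lra. }
    assert (Cmod (A x) * Cmod (x * x * x * q3 (c + x)%C) <= M * (t ^ 3 * B)).
    { apply Rmult_le_compat; auto using Cmod_ge_0. }
    lra. }
  assert (Ex : Cmod (A (RtoC t)) ^ 2 + Cmod (A (RtoC (- t))) ^ 2 +
    Cmod (A (Ci * RtoC t)%C) ^ 2 + Cmod (A (Ci * RtoC (- t))%C) ^ 2 =
    4 * Cmod a0 ^ 2 + 4 * t ^ 2 * Cmod a1 ^ 2 + 4 * t ^ 4 * Cmod a2 ^ 2).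
  { unfold A. clearbody a0 a1 a2. destruct a0 as [x0 y0], a1 as [x1 y1], a2 as [x2 y2].
    rewrite !Cmod2_alt. unfold RtoC, Ci, Cplus, Cmult, Re, Im; simpl. ring. }
  assert (0 <= t ^ 4 * Cmod a2 ^ 2) by (apply Rmult_le_pos; apply pow_le; [lra|apply Cmod_ge_0]).
  destruct (four_directions _ t ltac:(lra) P) as [P1 [P2 [P3 P4]]].
  lra.
Qed.

Lemma disc_complement_open (c : C) (r : R) (z : C) :
  ~ Cmod (z - c) <= r ->
  exists d, 0 < d /\ forall y, Cmod (y - z) < d -> ~ Cmod (y - c) <= r.
Proof.
  intros H. exists (Cmod (z - c) - r). split; [lra|]. intros y Hy.
  pose proof (Cmod_sub_triangle z y c). rewrite (Cmod_sub_sym z y) in H0. lra.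
Qed.

Lemma circle_complement_open (c : C) (r : R) (z : C) :
  Cmod (z - c) <> r ->
  exists d, 0 < d /\ forall y, Cmod (y - z) < d -> Cmod (y - c) <> r.
Proof.
  intros H. exists (Rabs (Cmod (z - c) - r)). split; [apply Rabs_pos_lt; lra|]. intros y Hy E.
  pose proof (Cmod_sub_triangle z y c) as H0. rewrite (Cmod_sub_sym z y) in H0.
  pose proof (Cmod_sub_triangle y z c) as H1.
  revert Hy. unfold Rabs. destruct Rcase_abs; lra.
Qed.

Lemma disc_bounded (c z : C) (r : R) : Cmod (z - c) <= r -> Cmod z <= Cmod c + r.
Proof. intros H. pose proof (Cmod_sub_ge z c). lra. Qed.

Lemma Cmod_continuous (g : C -> C) (c : C) :
  continuous_at g c -> forall e, 0 < e -> exists d, 0 < d /\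
    forall z, Cmod (z - c) < d -> Rabs (Cmod (g z) - Cmod (g c)) < e.
Proof.
  intros Hg e He. destruct (Hg e He) as [d [Hd H]]. exists d. split; [exact Hd|].
  intros z Hz. specialize (H z Hz).
  pose proof (Cmod_sub_ge (g z) (g c)) as H1. pose proof (Cmod_sub_ge (g c) (g z)) as H2.
  rewrite (Cmod_sub_sym (g c)) in H2. apply Rabs_def1; lra.
Qed.

Lemma Cmod_sqr_continuous (g : C -> C) (c : C) :
  continuous_at g c -> forall e, 0 < e -> exists d, 0 < d /\
    forall z, Cmod (z - c) < d -> Rabs (Cmod (g z) ^ 2 - Cmod (g c) ^ 2) < e.
Proof.
  intros Hg e He. set (m := Cmod (g c)). assert (Hm : 0 <= m) by apply Cmod_ge_0.
  assert (H0 : 0 < Rmin 1 (e / (2 * m + 1))).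
  { apply Rmin_glb_lt; [lra|]. apply Rdiv_lt_0_compat; lra. }
  destruct (Cmod_continuous g c Hg _ H0) as [d [Hd H]].
  exists d. split; [exact Hd|]. intros z Hz. specialize (H z Hz). fold m in H.
  pose proof (Rmin_l 1 (e / (2 * m + 1))). pose proof (Rmin_r 1 (e / (2 * m + 1))).
  replace (Cmod (g z) ^ 2 - m ^ 2) with ((Cmod (g z) - m) * (Cmod (g z) + m)) by ring.
  rewrite Rabs_mult. pose proof (Cmod_ge_0 (g z)).
  rewrite (Rabs_pos_eq (Cmod (g z) + m)) by lra.
  assert (Cmod (g z) + m < 2 * m + 1).
  { pose proof (Rle_abs (Cmod (g z) - m)). lra. }
  apply Rle_lt_trans with (Rabs (Cmod (g z) - m) * (2 * m + 1)).
  - apply Rmult_le_compat_l; [apply Rabs_pos|lra].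
  - replace e with (e / (2 * m + 1) * (2 * m + 1)) by (field; lra).
    apply Rmult_lt_compat_r; lra.
Qed.

Lemma le_of_small_penalty (a b k : R) :
  (forall e, 0 < e -> a <= b + e * k) -> a <= b.
Proof.
  intros H. destruct (Rle_lt_dec a b) as [|Hlt]; [assumption|]. exfalso.
  destruct (Rle_lt_dec k 0).
  - specialize (H 1 Rlt_0_1). lra.
  - assert (0 < (a - b) / (2 * k)) by (apply Rdiv_lt_0_compat; lra).
    specialize (H _ H0). replace ((a - b) / (2 * k) * k) with ((a - b) / 2) in H by (field; lra). lra.
Qed.

(** With the penalty [e |z - c|^2], whose sum over the four points exceeds
    four times the central value by [4 e t^2], an interior maximum of
    [|g|^2 + e |z - c|^2] contradicts [four_point_mean]. *)
Lemma max_modulus (g : C -> C) (c : C) (r M : R) :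
  0 < r -> (forall z, Cmod (z - c) <= r -> smooth_at g z) ->
  (forall z, Cmod (z - c) = r -> Cmod (g z) <= M) ->
  forall z, Cmod (z - c) <= r -> Cmod (g z) <= M.
Proof.
  intros Hr Hg HM z Hz.
  assert (HM0 : 0 <= M).
  { apply Rle_trans with (Cmod (g (c + RtoC r)%C)); [apply Cmod_ge_0|]. apply HM.
    replace (c + RtoC r - c)%C with (RtoC r) by ring. rewrite Cmod_R, Rabs_pos_eq; lra. }
  apply Rsqr_incr_0_var; [rewrite !Rsqr_pow2|exact HM0].
  apply le_of_small_penalty with (r ^ 2). intros e He.
  (* The excess e r^2 over M^2 vanishes with e. *)
  pose (Phi := fun z => Cmod (g z) ^ 2 + e * Cmod (z - c) ^ 2).
  destruct (compact_max (fun z => Cmod (z - c) <= r) Phi (Cmod c + r) c) as [m [Hm Hmax]].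
  - rewrite Cmod_sub_diag. lra.
  - intros y. apply disc_bounded.
  - intros y. apply disc_complement_open.
  - intros y Hy e' He'.
    destruct (Cmod_sqr_continuous g y (smooth_continuous _ _ (Hg y Hy)) (e' / 2) ltac:(lra)) as [d1 [Hd1 H1]].
    destruct (Cmod_sqr_continuous (fun z => z - c)%C y) with (e := e' / (2 * e)) as [d2 [Hd2 H2]].
    { apply smooth_continuous, smooth_minus_const, smooth_id. }
    { apply Rdiv_lt_0_compat; lra. }
    exists (Rmin d1 d2). split; [now apply Rmin_glb_lt|]. intros x _ Hx.
    pose proof (Rmin_l d1 d2). pose proof (Rmin_r d1 d2).
    specialize (H1 x ltac:(lra)). specialize (H2 x ltac:(lra)). unfold Phi.
    apply Rabs_def2 in H1. apply Rabs_def2 in H2.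
    assert (e * (Cmod (x - c) ^ 2 - Cmod (y - c) ^ 2) < e' / 2).
    { replace (e' / 2) with (e * (e' / (2 * e))) by (field; lra).
      apply Rmult_lt_compat_l; lra. }
    lra.
  - assert (Hc : Cmod (m - c) = r).
    { destruct (Rle_lt_or_eq_dec _ _ Hm) as [Hlt|]; [exfalso|assumption].
      destruct (four_point_mean g m (Hg m Hm)) as [K [d [Hd H]]].
      destruct (quadratic_beats_cubic K (4 * e) (Rmin d (r - Cmod (m - c)))) as [t [Ht HtK]];
        [lra|apply Rmin_glb_lt; lra|].
      pose proof (Rmin_l d (r - Cmod (m - c))). pose proof (Rmin_r d (r - Cmod (m - c))).
      specialize (H t ltac:(lra)).
      assert (Q : forall x, Cmod x = t -> Phi (m + x)%C <= Phi m).
      { intros x Hx. apply Hmax. pose proof (Cmod_sub_triangle (m + x) m c) as T.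
        replace (m + x - m)%C with x in T by ring. lra. }
      clear Hmax. destruct (four_directions _ t ltac:(lra) Q) as [Q1 [Q2 [Q3 Q4]]].
      unfold Phi in Q1, Q2, Q3, Q4.
      assert (Ex : Cmod (m + RtoC t - c) ^ 2 + Cmod (m + RtoC (- t) - c) ^ 2 +
        Cmod (m + Ci * RtoC t - c) ^ 2 + Cmod (m + Ci * RtoC (- t) - c) ^ 2 =
        4 * Cmod (m - c) ^ 2 + 4 * t ^ 2).
      { destruct m as [x y], c as [x' y']. rewrite !Cmod2_alt.
        unfold RtoC, Ci, Cplus, Cminus, Copp, Cmult, Re, Im; simpl. ring. }
      assert (0 <= 4 * t ^ 2 * Cmod (C_derive g m) ^ 2).
      { apply Rmult_le_pos; [apply Rmult_le_pos; [lra|]|]; apply pow2_ge_0. }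
      apply (f_equal (Rmult e)) in Ex.
      lra. }
    specialize (Hmax z Hz). unfold Phi in Hmax. rewrite Hc in Hmax.
    assert (Cmod (g m) ^ 2 <= M ^ 2) by (apply pow_incr; split; [apply Cmod_ge_0|auto]).
    assert (0 <= e * Cmod (z - c) ^ 2) by (apply Rmult_le_pos; [lra|apply pow_le, Cmod_ge_0]).
    lra.
Qed.

Lemma min_modulus (g : C -> C) (c : C) (r M : R) :
  0 < r -> (forall z, Cmod (z - c) <= r -> smooth_at g z) ->
  (forall z, Cmod (z - c) <= r -> g z <> 0%C) ->
  (forall z, Cmod (z - c) = r -> M <= Cmod (g z)) ->
  forall z, Cmod (z - c) <= r -> M <= Cmod (g z).
Proof.
  intros Hr Hg H0 HM z Hz.
  destruct (Rle_lt_dec M 0) as [HM0|HM0]; [pose proof (Cmod_ge_0 (g z)); lra|].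
  assert (Hp : forall y, Cmod (y - c) <= r -> 0 < Cmod (g y)).
  { intros y Hy. now apply Cmod_gt_0, H0. }
  rewrite <- (Rinv_inv M), <- (Rinv_inv (Cmod (g z))).
  apply Rinv_le_contravar; [now apply Rinv_0_lt_compat, Hp|].
  rewrite <- Cmod_inv by auto.
  apply (max_modulus (fun y => / g y)%C c r); auto.
  - intros y Hy. apply smooth_inv; auto.
  - intros y Hy. rewrite Cmod_inv by (apply H0; lra).
    apply Rinv_le_contravar; auto.
Qed.

Lemma circle_lower_bound (g : C -> C) (c : C) (r : R) :
  0 < r -> (forall z, Cmod (z - c) = r -> continuous_at g z) ->
  (forall z, Cmod (z - c) = r -> g z <> 0%C) ->
  exists mu, 0 < mu /\ forall z, Cmod (z - c) = r -> mu <= Cmod (g z).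
Proof.
  intros Hr Hg H0.
  destruct (compact_max (fun z => Cmod (z - c) = r) (fun z => - Cmod (g z)) (Cmod c + r) (c + RtoC r)%C)
    as [m [Hm Hmax]].
  - replace (c + RtoC r - c)%C with (RtoC r) by ring. rewrite Cmod_R, Rabs_pos_eq; lra.
  - intros z Hz. apply disc_bounded. lra.
  - intros z Hz. now apply circle_complement_open.
  - intros z Hz e He. destruct (Cmod_continuous g z (Hg z Hz) e He) as [d [Hd H]].
    exists d. split; [exact Hd|]. intros y _ Hy. specialize (H y Hy).
    apply Rabs_def2 in H. lra.
  - exists (Cmod (g m)). split; [now apply Cmod_gt_0, H0|].
    intros z Hz. specialize (Hmax z Hz). lra.
Qed.

Lemma unit_disc_near (z : C) : unit_disc z -> exists d, 0 < d /\
  forall y, Cmod (y - z) <= d -> unit_disc y.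
Proof.
  unfold unit_disc. intros H. exists ((1 - Cmod z) / 2). split; [lra|]. intros y Hy.
  pose proof (disc_bounded _ _ _ Hy). lra.
Qed.

(** * The Schwarz lemma *)

Definition smooth_on_disc (g : C -> C) : Prop := forall z, unit_disc z -> smooth_at g z.

Lemma Cminus_0_r (z : C) : (z - 0)%C = z.
Proof. ring. Qed.

Lemma unit_disc_0 : unit_disc 0.
Proof. unfold unit_disc. rewrite Cmod_0. lra. Qed.

(** On [|y| = r] the slope [w y / y] is at most [1 / r]; a value [s > 1] is
    excluded by a radius [r] between [1 / s] and [1]. *)
Lemma schwarz_slope (w : C -> C) :
  smooth_on_disc w -> w 0%C = 0%C -> (forall z, unit_disc z -> unit_disc (w z)) ->
  forall z, unit_disc z -> Cmod (slope w 0 z) <= 1.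
Proof.
  intros Hw H0 Hd z Hz.
  assert (Hz1 := Hz). unfold unit_disc in Hz1.
  destruct (Rle_lt_dec (Cmod (slope w 0 z)) 1) as [|Hgt]; [assumption|exfalso].
  set (s := Cmod (slope w 0 z)) in *.
  assert (Hs1 : / s < 1) by (rewrite <- Rinv_1; apply Rinv_lt_contravar; lra).
  assert (Hs0 : 0 < / s) by (apply Rinv_0_lt_compat; lra).
  (* The radius must also exceed |z|. *)
  pose (r := (1 + Rmax (Cmod z) (/ s)) / 2).
  pose proof (Rmax_l (Cmod z) (/ s)). pose proof (Rmax_r (Cmod z) (/ s)).
  assert (Rmax (Cmod z) (/ s) < 1) by now apply Rmax_lub_lt.
  assert (Hr : 0 < r < 1) by (unfold r; lra).
  assert (Hrs : / s < r) by (unfold r; lra).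
  assert (Hb : s <= / r).
  { apply (max_modulus (slope w 0) 0 r); [lra| | |].
    - intros y Hy. rewrite Cminus_0_r in Hy.
      apply smooth_slope; apply Hw; [apply unit_disc_0|]. unfold unit_disc; lra.
    - intros y Hy. rewrite Cminus_0_r in Hy.
      rewrite slope_off by (intros ->; rewrite Cmod_0 in Hy; lra).
      rewrite H0, !Cminus_0_r, Cmod_div by (intros ->; rewrite Cmod_0 in Hy; lra).
      rewrite Hy. unfold Rdiv. rewrite <- (Rmult_1_l (/ r)) at 2.
      apply Rmult_le_compat_r; [left; apply Rinv_0_lt_compat; lra|].
      left. apply Hd. unfold unit_disc. lra.
    - rewrite Cminus_0_r. unfold r; lra. }
  assert (/ r < s).
  { rewrite <- (Rinv_inv s). apply Rinv_lt_contravar; [|lra]. apply Rmult_lt_0_compat; lra. }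
  lra.
Qed.

Lemma schwarz (w : C -> C) :
  smooth_on_disc w -> w 0%C = 0%C -> (forall z, unit_disc z -> unit_disc (w z)) ->
  forall z, unit_disc z -> Cmod (w z) <= Cmod z.
Proof.
  intros Hw H0 Hd z Hz. rewrite (slope_eq w 0 z), H0.
  replace (0 + (z - 0) * slope w 0 z)%C with (z * slope w 0 z)%C by ring.
  rewrite Cmod_mult. pose proof (schwarz_slope w Hw H0 Hd z Hz).
  pose proof (Cmod_ge_0 z). nra.
Qed.

(** * Derivatives along curves *)

(** Componentwise, so that the real calculus applies to [Re] and [Im] of a
    function along a curve. *)
Definition curve_derive (gamma : R -> C) (t : R) (v : C) : Prop :=
  is_derive (fun s => Re (gamma s)) t (Re v) /\ is_derive (fun s => Im (gamma s)) t (Im v).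

Lemma curve_derive_expansion (gamma : R -> C) (t : R) (v : C) :
  curve_derive gamma t v <->
  forall e, 0 < e -> exists d, 0 < d /\ forall h, Rabs h < d ->
    Cmod (gamma (t + h)%R - gamma t - RtoC h * v) <= e * Rabs h.
Proof.
  unfold curve_derive. rewrite !is_derive_Reals. unfold derivable_pt_lim. split.
  - intros [HR HI] e He.
    destruct (HR (e / 2) ltac:(lra)) as [d1 H1]. destruct (HI (e / 2) ltac:(lra)) as [d2 H2].
    exists (Rmin d1 d2). split; [apply Rmin_glb_lt; apply cond_pos|]. intros h Hh.
    pose proof (Rmin_l d1 d2). pose proof (Rmin_r d1 d2).
    destruct (Req_dec h 0) as [->|Hh0].
    { rewrite Rplus_0_r. replace (gamma t - gamma t - RtoC 0 * v)%C with (RtoC 0) by ring.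
      rewrite Cmod_0, Rabs_R0. lra. }
    specialize (H1 h Hh0 ltac:(lra)). specialize (H2 h Hh0 ltac:(lra)).
    set (X := (Re (gamma (t + h)%R) - Re (gamma t)) / h - Re v) in *.
    set (Y := (Im (gamma (t + h)%R) - Im (gamma t)) / h - Im v) in *.
    replace (gamma (t + h)%R - gamma t - RtoC h * v)%C with (RtoC h * (RtoC X + Ci * RtoC Y))%C.
    + rewrite Cmod_mult, Cmod_R, Rmult_comm. apply Rmult_le_compat_r; [apply Rabs_pos|].
      eapply Rle_trans; [apply Cmod_triangle|]. rewrite Cmod_mult, Cmod_Ci, !Cmod_R. lra.
    + unfold X, Y. destruct (gamma (t + h)%R) as [a b], (gamma t) as [a' b'], v as [v1 v2].
      apply injective_projections; simpl; field; auto.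
  - intros H.
    assert (Q : forall e, 0 < e -> exists d : posreal, forall h, h <> 0 -> Rabs h < d ->
       Rabs ((Re (gamma (t + h)%R) - Re (gamma t)) / h - Re v) < e /\
       Rabs ((Im (gamma (t + h)%R) - Im (gamma t)) / h - Im v) < e).
    { intros e He. destruct (H (e / 2) ltac:(lra)) as [d [Hd H1]].
      exists (mkposreal d Hd). intros h Hh0 Hh. specialize (H1 h Hh).
      assert (Hp : 0 < Rabs h) by now apply Rabs_pos_lt.
      pose proof (Rmax_Cmod (gamma (t + h)%R - gamma t - RtoC h * v)%C) as Hm.
      set (Z := (gamma (t + h)%R - gamma t - RtoC h * v)%C) in *.
      assert (ER : fst Z = h * ((Re (gamma (t + h)%R) - Re (gamma t)) / h - Re v)).
      { unfold Z. destruct (gamma (t + h)%R) as [a b], (gamma t) as [a' b'], v as [v1 v2].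
        unfold RtoC, Cplus, Cminus, Copp, Cmult, Re, Im; simpl. field; auto. }
      assert (EI : snd Z = h * ((Im (gamma (t + h)%R) - Im (gamma t)) / h - Im v)).
      { unfold Z. destruct (gamma (t + h)%R) as [a b], (gamma t) as [a' b'], v as [v1 v2].
        unfold RtoC, Cplus, Cminus, Copp, Cmult, Re, Im; simpl. field; auto. }
      rewrite ER, EI, !Rabs_mult in Hm.
      set (X := Rabs ((Re (gamma (t + h)%R) - Re (gamma t)) / h - Re v)) in *.
      set (Y := Rabs ((Im (gamma (t + h)%R) - Im (gamma t)) / h - Im v)) in *.
      pose proof (Rmax_l (Rabs h * X) (Rabs h * Y)). pose proof (Rmax_r (Rabs h * X) (Rabs h * Y)).
      split; apply Rle_lt_trans with (e / 2); try lra;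
        apply Rmult_le_reg_l with (Rabs h); lra. }
    split; intros e He; destruct (Q e He) as [d Hd]; exists d; intros h Hh0 Hh;
      apply (Hd h Hh0 Hh).
Qed.

Lemma curve_derive_comp (g : C -> C) (gamma : R -> C) (t : R) (v : C) :
  smooth_at g (gamma t) -> curve_derive gamma t v ->
  curve_derive (fun s => g (gamma s)) t (v * C_derive g (gamma t))%C.
Proof.
  intros Hg Hv. apply curve_derive_expansion. rewrite curve_derive_expansion in Hv.
  intros e He. set (c := gamma t) in *. pose (q := slope g c).
  assert (Hq : continuous_at q c) by now apply smooth_continuous, smooth_slope.
  set (a := C_derive g c).
  assert (Hqc : q c = a) by apply slope_diag.
  pose proof (Cmod_ge_0 v). pose proof (Cmod_ge_0 a).
  assert (He1 : 0 < Rmin 1 (e / (2 * (Cmod v + 1)))).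
  { apply Rmin_glb_lt; [lra|]. apply Rdiv_lt_0_compat; lra. }
  set (e1 := Rmin 1 (e / (2 * (Cmod v + 1)))) in *.
  destruct (Hq e1 He1) as [d1 [Hd1 H1]].
  assert (He2 : 0 < Rmin 1 (e / (2 * (Cmod a + 1)))).
  { apply Rmin_glb_lt; [lra|]. apply Rdiv_lt_0_compat; lra. }
  set (e2 := Rmin 1 (e / (2 * (Cmod a + 1)))) in *.
  destruct (Hv e2 He2) as [d2 [Hd2 H2]].
  exists (Rmin d2 (d1 / (Cmod v + 1))).
  split. { apply Rmin_glb_lt; auto. apply Rdiv_lt_0_compat; lra. }
  intros h Hh. pose proof (Rmin_l d2 (d1 / (Cmod v + 1))). pose proof (Rmin_r d2 (d1 / (Cmod v + 1))).
  specialize (H2 h ltac:(lra)).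
  set (D := (gamma (t + h)%R - c)%C) in *.
  assert (HD : Cmod D <= Rabs h * (Cmod v + 1)).
  { replace D with ((D - RtoC h * v) + RtoC h * v)%C by ring.
    eapply Rle_trans; [apply Cmod_triangle|]. rewrite (Cmod_mult (RtoC h)), Cmod_R.
    assert (e2 <= 1) by apply Rmin_l. pose proof (Rabs_pos h). nra. }
  assert (HDd : Cmod D < d1).
  { eapply Rle_lt_trans; [exact HD|].
    replace d1 with (d1 / (Cmod v + 1) * (Cmod v + 1)) by (field; lra).
    apply Rmult_lt_compat_r; lra. }
  specialize (H1 (gamma (t + h)%R) HDd). rewrite Hqc in H1.
  rewrite (slope_eq g c (gamma (t + h)%R)). fold q. fold D.
  replace (g c + D * q (gamma (t + h)%R) - g c - RtoC h * (v * a))%C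
    with (D * (q (gamma (t + h)%R) - a) + (D - RtoC h * v) * a)%C by ring.
  eapply Rle_trans; [apply Cmod_triangle|]. rewrite !Cmod_mult.
  assert (A1 : Cmod D * Cmod (q (gamma (t + h)%R) - a) <= Rabs h * (e / 2)).
  { apply Rle_trans with (Rabs h * (Cmod v + 1) * e1).
    - apply Rmult_le_compat; auto using Cmod_ge_0. lra.
    - rewrite Rmult_assoc. apply Rmult_le_compat_l; [apply Rabs_pos|].
      apply Rle_trans with ((Cmod v + 1) * (e / (2 * (Cmod v + 1)))).
      + apply Rmult_le_compat_l; [lra|apply Rmin_r].
      + right. field. lra. }
  assert (A2 : Cmod (D - RtoC h * v) * Cmod a <= Rabs h * (e / 2)).
  { apply Rle_trans with (e2 * Rabs h * (Cmod a + 1)).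
    - apply Rmult_le_compat; auto using Cmod_ge_0; lra.
    - replace (e2 * Rabs h * (Cmod a + 1)) with (Rabs h * (e2 * (Cmod a + 1))) by ring.
      apply Rmult_le_compat_l; [apply Rabs_pos|].
      apply Rle_trans with (e / (2 * (Cmod a + 1)) * (Cmod a + 1)).
      + apply Rmult_le_compat_r; [lra|apply Rmin_r].
      + right. field. lra. }
  lra.
Qed.

Lemma curve_derive_line (c v : C) (t : R) : curve_derive (fun s => c + RtoC s * v)%C t v.
Proof.
  apply curve_derive_expansion. intros e He. exists 1. split; [lra|]. intros h _.
  replace (c + RtoC (t + h) * v - (c + RtoC t * v) - RtoC h * v)%C with (RtoC 0).
  - rewrite Cmod_0. pose proof (Rabs_pos h). nra.
  - rewrite RtoC_plus. ring.
Qed.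

Lemma constant_of_zero_derivative (g : C -> C) (c z : C) (d : R) :
  (forall y, Cmod (y - c) < d -> smooth_at g y) ->
  (forall y, Cmod (y - c) < d -> C_derive g y = 0%C) ->
  Cmod (z - c) < d -> g z = g c.
Proof.
  intros Hg H0 Hz.
  assert (Hin : forall t, 0 <= t <= 1 -> Cmod (c + RtoC t * (z - c) - c) < d).
  { intros t Ht. replace (c + RtoC t * (z - c) - c)%C with (RtoC t * (z - c))%C by ring.
    rewrite Cmod_mult, Cmod_R, Rabs_pos_eq by lra. pose proof (Cmod_ge_0 (z - c)). nra. }
  assert (HD : forall t, 0 <= t <= 1 ->
    curve_derive (fun s => g (c + RtoC s * (z - c))%C) t 0%C).
  { intros t Ht. replace (RtoC 0) with ((z - c) * C_derive g (c + RtoC t * (z - c)))%C.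
    - apply (curve_derive_comp g (fun s => c + RtoC s * (z - c))%C);
        [now apply Hg, Hin|apply curve_derive_line].
    - rewrite H0 by now apply Hin. ring. }
  assert (E : forall p : C -> R, (forall t, 0 <= t <= 1 ->
    is_derive (fun s => p (g (c + RtoC s * (z - c))%C)) t 0) -> p (g c) = p (g z)).
  { intros p Hp. pose proof (eq_is_derive (V := R_NormedModule)
      (fun s => p (g (c + RtoC s * (z - c))%C)) 0 1 Hp Rlt_0_1) as Hq. simpl in Hq.
    replace (c + 0 * (z - c))%C with c in Hq by ring.
    replace (c + 1 * (z - c))%C with z in Hq by ring. exact Hq. }
  symmetry. apply injective_projections.
  - apply (E Re). intros t Ht. exact (proj1 (HD t Ht)).
  - apply (E Im). intros t Ht. exact (proj2 (HD t Ht)).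
Qed.

(** * Injective functions *)

(** Near [c] there are points [z] with [g' z <> 0], as otherwise [g] would be
    constant there.  For such [z], the slope of [g] at [z] has no zero in the
    disc, so the minimum principle bounds it below by its values on the boundary
    circle, uniformly as [z] tends to [c].  Evaluated at [c], this bound
    passes to the limit [g' c]. *)
Lemma injective_derive_neq_0 (g : C -> C) (c : C) (r : R) :
  0 < r -> (forall z, Cmod (z - c) <= r -> smooth_at g z) ->
  (forall x y, Cmod (x - c) <= r -> Cmod (y - c) <= r -> g x = g y -> x = y) ->
  C_derive g c <> 0%C.
Proof.
  intros Hr Hg Hinj Hc0.
  assert (Hcc : Cmod (c - c) <= r) by (rewrite Cmod_sub_diag; lra).
  destruct (circle_lower_bound (fun z => g z - g c)%C c r Hr) as [mu [Hmu Hlow]].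
  { intros z Hz. apply smooth_continuous, smooth_minus_const, Hg. lra. }
  { intros z Hz. apply Csub_neq_0. intros E. apply Hinj in E; [|lra|exact Hcc].
    subst z. rewrite Cmod_sub_diag in Hz. lra. }
  destruct (smooth_continuous _ _ (Hg c Hcc) (mu / 2)) as [d1 [Hd1 H1]]; [lra|].
  destruct (smooth_continuous _ _ (smooth_slope g c c (Hg c Hcc) (Hg c Hcc)) (mu / (8 * r)))
    as [d2 [Hd2 H2]]; [apply Rdiv_lt_0_compat; lra|].
  rewrite slope_diag, Hc0 in H2.
  pose (d := Rmin (Rmin d1 d2) r).
  assert (Hd : 0 < d) by (unfold d; repeat apply Rmin_glb_lt; auto).
  assert (Hdd1 : d <= d1) by (unfold d; eapply Rle_trans; apply Rmin_l).
  assert (Hdd2 : d <= d2) by (unfold d; eapply Rle_trans; [apply Rmin_l|apply Rmin_r]).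
  assert (Hdr : d <= r) by (unfold d; apply Rmin_r).
  destruct (classic (exists z, Cmod (z - c) < d /\ C_derive g z <> 0%C)) as [[z [Hz Hz0]]|Hno].
  - assert (Hne : z <> c) by congruence.
    assert (Hm : mu / (4 * r) <= Cmod (slope g z c)).
    { apply (min_modulus (slope g z) c r); auto.
      - intros y Hy. apply smooth_slope; apply Hg; lra.
      - intros y Hy E. destruct (Ceq_dec y z) as [->|Hyz].
        + rewrite slope_diag in E. contradiction.
        + apply Hyz, Hinj; [lra|lra|]. rewrite (slope_eq g z y), E. ring.
      - intros y Hy.
        destruct (Ceq_dec y z) as [->|Hyz]; [lra|].
        rewrite slope_off, Cmod_div by auto using Csub_neq_0.
        assert (N1 : mu / 2 <= Cmod (g y - g z)).
        { specialize (Hlow y Hy). specialize (H1 z ltac:(lra)).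
          pose proof (Cmod_sub_triangle (g y) (g z) (g c)). lra. }
        assert (N2 : Cmod (y - z) <= 2 * r).
        { pose proof (Cmod_sub_triangle y c z). rewrite (Cmod_sub_sym c z) in H. lra. }
        assert (N3 : 0 < Cmod (y - z)) by now apply Cmod_gt_0, Csub_neq_0.
        apply Rmult_le_reg_r with (Cmod (y - z)); [exact N3|].
        replace (Cmod (g y - g z) / Cmod (y - z) * Cmod (y - z)) with (Cmod (g y - g z)) by (field; lra).
        apply Rle_trans with (mu / (4 * r) * (2 * r)).
        + apply Rmult_le_compat_l; [|exact N2]. left. apply Rdiv_lt_0_compat; lra.
        + replace (mu / (4 * r) * (2 * r)) with (mu / 2) by (field; lra). exact N1. }
    specialize (H2 z ltac:(lra)). rewrite Cminus_0_r, slope_off in H2 by exact Hne.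
    rewrite slope_off in Hm by congruence.
    replace ((g c - g z) / (c - z))%C with ((g z - g c) / (z - c))%C in Hm
      by (field; split; apply Csub_neq_0; congruence).
    replace (mu / (4 * r)) with (2 * (mu / (8 * r))) in Hm by (field; lra).
    assert (0 < mu / (8 * r)) by (apply Rdiv_lt_0_compat; lra). lra.
  - assert (Hin : Cmod (c + RtoC (d / 2) - c) = d / 2).
    { replace (c + RtoC (d / 2) - c)%C with (RtoC (d / 2)) by ring.
      rewrite Cmod_R, Rabs_pos_eq; lra. }
    assert (E : g (c + RtoC (d / 2))%C = g c).
    { apply (constant_of_zero_derivative g c _ d); [| |lra].
      - intros y Hy. apply Hg. lra.
      - intros y Hy. apply NNPP. intros Hy0. apply Hno. now exists y. }
    apply Hinj in E; [|lra|exact Hcc]. rewrite E, Cmod_sub_diag in Hin. lra.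
Qed.

(** If [v] close to [g c] were omitted, [g - v] would have no zero in the disc,
    although it is smaller at the centre than on the boundary circle. *)
Lemma injective_open (g : C -> C) (c : C) (r : R) :
  0 < r -> (forall z, Cmod (z - c) <= r -> smooth_at g z) ->
  (forall x y, Cmod (x - c) <= r -> Cmod (y - c) <= r -> g x = g y -> x = y) ->
  exists e, 0 < e /\ forall v, Cmod (v - g c) < e ->
    exists z, Cmod (z - c) < r /\ g z = v.
Proof.
  intros Hr Hg Hinj.
  assert (Hcc : Cmod (c - c) <= r) by (rewrite Cmod_sub_diag; lra).
  destruct (circle_lower_bound (fun z => g z - g c)%C c r Hr) as [mu [Hmu Hlow]].
  { intros z Hz. apply smooth_continuous, smooth_minus_const, Hg. lra. }
  { intros z Hz. apply Csub_neq_0. intros E. apply Hinj in E; [|lra|exact Hcc].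
    subst z. rewrite Cmod_sub_diag in Hz. lra. }
  exists (mu / 2). split; [lra|]. intros v Hv. apply NNPP. intros Hno.
  assert (Hc : forall z, Cmod (z - c) = r -> mu / 2 <= Cmod (g z - v)).
  { intros z Hz. specialize (Hlow z Hz). pose proof (Cmod_sub_triangle (g z) v (g c)). lra. }
  assert (mu / 2 <= Cmod (g c - v)).
  { apply (min_modulus (fun z => g z - v)%C c r); auto.
    - intros z Hz. now apply smooth_minus_const, Hg.
    - intros z Hz. destruct (Rle_lt_or_eq_dec _ _ Hz) as [Hlt|Heq].
      + apply Csub_neq_0. intros E. apply Hno. now exists z.
      + apply Cmod_gt_0. specialize (Hc z Heq). lra. }
  rewrite Cmod_sub_sym in H. lra.
Qed.

Lemma unit_disc_conj (z : C) : unit_disc z -> unit_disc (Cconj z).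
Proof. unfold unit_disc. now rewrite Cmod_conj. Qed.

Lemma univalent_derive_neq_0 (g : C -> C) (c : C) :
  smooth_on_disc g -> univalent_on_disc g -> unit_disc c -> C_derive g c <> 0%C.
Proof.
  intros Hg Hu Hc. destruct (unit_disc_near c Hc) as [d [Hd H]].
  apply (injective_derive_neq_0 g c d Hd).
  - intros z Hz. now apply Hg, H.
  - intros x y Hx Hy. apply Hu; now apply H.
Qed.

(** Openness of [g] at [t c], together with injectivity, gives the continuity of
    the lift [t]; then the inverse function lemma applies. *)
Lemma univalent_lift_smooth (g p t : C -> C) :
  smooth_on_disc g -> univalent_on_disc g -> smooth_on_disc p ->
  (forall z, unit_disc z -> unit_disc (t z)) ->
  (forall z, unit_disc z -> g (t z) = p z) ->
  smooth_on_disc t.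
Proof.
  intros Hg Hu Hp Ht E c Hc. destruct (unit_disc_near c Hc) as [d [Hd Hin]].
  apply (smooth_inverse_function g p t c d); auto.
  - intros e He. destruct (unit_disc_near (t c) (Ht c Hc)) as [d1 [Hd1 Hin1]].
    pose (r := Rmin d1 e). assert (Hr : 0 < r) by now apply Rmin_glb_lt.
    assert (Hrd : r <= d1) by apply Rmin_l. assert (Hre : r <= e) by apply Rmin_r.
    destruct (injective_open g (t c) r Hr) as [mu [Hmu Hop]].
    + intros z Hz. apply Hg, Hin1. lra.
    + intros x y Hx Hy. apply Hu; apply Hin1; lra.
    + destruct (smooth_continuous _ _ (Hp c Hc) mu Hmu) as [d2 [Hd2 H2]].
      exists (Rmin d d2). split; [now apply Rmin_glb_lt|]. intros z Hz.
      pose proof (Rmin_l d d2). pose proof (Rmin_r d d2).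
      assert (Hzd : unit_disc z) by (apply Hin; lra).
      destruct (Hop (p z)) as [y [Hy Ey]].
      { rewrite (E c Hc). apply H2. lra. }
      replace (t z) with y; [lra|]. apply Hu; auto.
      * apply Hin1. lra.
      * now rewrite E.
  - now apply univalent_derive_neq_0; auto.
  - intros z Hz. apply E, Hin. lra.
Qed.

(** * Conjugation symmetry *)

(** A mean of [|g|^2] equal to [1] leaves no room for the term [t^2 |g' c|^2]. *)
Lemma unimodular_derive_0 (g : C -> C) (c : C) (d : R) :
  0 < d -> smooth_at g c -> (forall z, Cmod (z - c) < d -> Cmod (g z) = 1) ->
  C_derive g c = 0%C.
Proof.
  intros Hd Hg H1. destruct (four_point_mean g c Hg) as [K [d1 [Hd1 H]]].
  apply Cmod_eq_0. set (m := Cmod (C_derive g c)) in *.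
  destruct (Req_dec m 0) as [|Hm]; [assumption|exfalso].
  assert (Hm0 : 0 < m) by (assert (0 <= m) by apply Cmod_ge_0; lra).
  assert (Hm2 : 0 < m ^ 2) by (apply pow_lt; lra).
  destruct (quadratic_beats_cubic K (4 * m ^ 2) (Rmin d d1)) as [t [Ht HtK]];
    [lra|now apply Rmin_glb_lt|].
  pose proof (Rmin_l d d1). pose proof (Rmin_r d d1). specialize (H t ltac:(lra)).
  assert (Q : forall x, Cmod x = t -> Cmod (g (c + x)%C) = 1).
  { intros x Hx. apply H1. replace (c + x - c)%C with x by ring. lra. }
  destruct (four_directions _ t ltac:(lra) Q) as [Q1 [Q2 [Q3 Q4]]].
  rewrite Q1, Q2, Q3, Q4, (H1 c) in H by (rewrite Cmod_sub_diag; lra). lra.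
Qed.

(** The Schwarz lemma for [t] and for its inverse [conj t conj] gives
    [|t z| = |z|].  So [t z / z] is unimodular, hence locally constant, and its
    value at [0] is the positive number [t' 0]. *)
Lemma conj_involution_identity (t : C -> C) :
  smooth_on_disc t -> t 0%C = 0%C ->
  (forall z, unit_disc z -> unit_disc (t z)) ->
  (forall z, unit_disc z -> Cconj (t (Cconj (t z))) = z) ->
  0 < Re (C_derive t 0) -> Im (C_derive t 0) = 0 ->
  forall z, unit_disc z -> t z = z.
Proof.
  intros Ht H0 Hd Hinv HR HI z Hz.
  assert (Hle : forall y, unit_disc y -> Cmod (t y) <= Cmod y) by now apply schwarz.
  assert (Heq : forall y, unit_disc y -> Cmod (t y) = Cmod y).
  { intros y Hy. apply Rle_antisym; [now apply Hle|].
    rewrite <- (Hinv y Hy) at 1. rewrite Cmod_conj, <- (Cmod_conj (t y)).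
    apply Hle. now apply unit_disc_conj, Hd. }
  (* phi z = t z / z; at 0 its modulus is 1 by the two modulus principles. *)
  pose (phi := slope t 0).
  assert (Sphi : smooth_on_disc phi).
  { intros y Hy. apply smooth_slope; apply Ht; auto using unit_disc_0. }
  assert (Hphi : forall y : C, y <> 0%C -> unit_disc y -> Cmod (phi y) = 1).
  { intros y Hy0 Hy. unfold phi. rewrite slope_off by exact Hy0.
    rewrite H0, !Cminus_0_r, Cmod_div, Heq by auto. field.
    apply Rgt_not_eq. now apply Cmod_gt_0. }
  assert (Hphi0 : Cmod (phi 0%C) = 1).
  { destruct (unit_disc_near 0 unit_disc_0) as [d [Hdp Hin]].
    apply Rle_antisym.
    - apply (max_modulus phi 0 d); [exact Hdp| | |].
      + intros y Hy. now apply Sphi, Hin.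
      + intros y Hy. right. apply Hphi; [|apply Hin; lra].
        intros ->. rewrite Cmod_sub_diag in Hy. lra.
      + rewrite Cmod_sub_diag. lra.
    - destruct (Req_dec (Cmod (phi 0%C)) 0) as [E|E].
      + exfalso. apply Cmod_eq_0 in E. unfold phi in E. rewrite slope_diag in E.
        rewrite E in HR. simpl in HR. lra.
      + apply (min_modulus phi 0 d); [exact Hdp| | | |].
        * intros y Hy. now apply Sphi, Hin.
        * intros y Hy. destruct (Ceq_dec y 0) as [->|Hy0].
          -- intros E'. apply E. rewrite E'. apply Cmod_0.
          -- apply Cmod_gt_0. rewrite Hphi; auto. lra.
        * intros y Hy. right. symmetry. apply Hphi; [|apply Hin; lra].
          intros ->. rewrite Cmod_sub_diag in Hy. lra.
        * rewrite Cmod_sub_diag. lra. }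
  assert (Hphi' : forall y, unit_disc y -> Cmod (phi y) = 1).
  { intros y Hy. destruct (Ceq_dec y 0) as [->|]; auto. }
  assert (Hc : phi z = phi 0%C).
  { apply (constant_of_zero_derivative phi 0 z 1).
    - intros y Hy. rewrite Cminus_0_r in Hy. now apply Sphi.
    - intros y Hy. rewrite Cminus_0_r in Hy.
      destruct (unit_disc_near y Hy) as [d [Hdp Hin]].
      apply (unimodular_derive_0 phi y d); auto.
      intros x Hx. apply Hphi', Hin. lra.
    - rewrite Cminus_0_r. exact Hz. }
  assert (H1 : phi 0%C = 1%C).
  { revert Hphi0. unfold phi. rewrite slope_diag.
    set (a := C_derive t 0) in *. intros Ha.
    assert (Ea : a = RtoC (Re a)).
    { apply injective_projections; [reflexivity|exact HI]. }
    rewrite Ea, Cmod_R, Rabs_pos_eq in Ha by lra. now rewrite Ea, Ha. }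
  rewrite (slope_eq t 0 z). fold phi. rewrite Hc, H1, H0. ring.
Qed.

Lemma C_derive_comp (g t : C -> C) (c : C) :
  smooth_at g (t c) -> smooth_at t c ->
  C_derive (fun z => g (t z)) c = (C_derive g (t c) * C_derive t c)%C.
Proof.
  intros Hg Ht. rewrite <- (slope_diag g), <- (slope_diag t).
  apply (C_derive_of_slope _ (fun z => slope g (t c) (t z) * slope t c z)%C c 1); [lra| |].
  - intros z _. rewrite (slope_eq g (t c) (t z)).
    rewrite (slope_eq t c z) at 1. ring.
  - apply smooth_continuous, smooth_mult; [|now apply smooth_slope].
    apply (smooth_comp (slope g (t c)) t); auto. now apply smooth_slope.
Qed.

Lemma C_derive_conj (g : C -> C) (c : C) :
  smooth_at g (Cconj c) ->
  C_derive (fun z => Cconj (g (Cconj z))) c = Cconj (C_derive g (Cconj c)).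
Proof.
  intros Hg. rewrite <- (slope_diag g).
  rewrite (C_derive_of_slope _ (fun z => Cconj (slope g (Cconj c) (Cconj z))) c 1); [reflexivity|lra| |].
  - intros z _. rewrite (slope_eq g (Cconj c) (Cconj z)).
    rewrite Cconj_plus, Cconj_mult, Cconj_minus, !Cconj_conj. reflexivity.
  - apply smooth_continuous, smooth_conj. now apply smooth_slope.
Qed.

Lemma C_derive_ext (g h : C -> C) (c : C) (d : R) :
  0 < d -> (forall z, Cmod (z - c) < d -> g z = h z) -> smooth_at g c ->
  C_derive g c = C_derive h c.
Proof.
  intros Hd E Hg. symmetry. rewrite <- (slope_diag g).
  apply (C_derive_of_slope h (slope g c) c d); auto.
  - intros z Hz. rewrite <- !E; auto; [|rewrite Cmod_sub_diag; lra]. apply slope_eq.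
  - apply smooth_continuous, smooth_slope; auto.
Qed.

(** The conjugate [conj psi conj] has the same image as [psi], so it lifts
    through [psi] to a self-map [t] of the disc, which turns out to be the
    identity. *)
Lemma conj_symmetric (psi : C -> C) :
  smooth_on_disc psi -> univalent_on_disc psi -> Im (psi 0%C) = 0 ->
  Im (C_derive psi 0) = 0 ->
  (forall z, unit_disc z -> exists z', unit_disc z' /\ psi z' = Cconj (psi z)) ->
  forall z, unit_disc z -> psi (Cconj z) = Cconj (psi z).
Proof.
  intros Hs Hu H0 HI Hsym.
  assert (Real_conj : forall x, Im x = 0 -> Cconj x = x).
  { intros [x y] Hx. simpl in Hx. subst y. unfold Cconj; simpl. f_equal. ring. }
  assert (D : forall z, exists t, unit_disc z -> unit_disc t /\ psi t = Cconj (psi (Cconj z))).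
  { intros z. destruct (classic (unit_disc z)) as [Hz|Hz].
    - destruct (Hsym (Cconj z) (unit_disc_conj z Hz)) as [t Ht]. now exists t.
    - exists 0%C. tauto. }
  pose (t := fun z => proj1_sig (constructive_indefinite_description _ (D z))).
  assert (Ht : forall z, unit_disc z -> unit_disc (t z) /\ psi (t z) = Cconj (psi (Cconj z))).
  { intros z. exact (proj2_sig (constructive_indefinite_description _ (D z))). }
  assert (Hsc : smooth_on_disc (fun z => Cconj (psi (Cconj z)))).
  { intros z Hz. apply smooth_conj, Hs. now apply unit_disc_conj. }
  assert (St : smooth_on_disc t).
  { apply (univalent_lift_smooth psi (fun z => Cconj (psi (Cconj z))) t); auto; intros z Hz; now apply Ht. }
  assert (C0 : Cconj 0 = 0%C) by (apply Real_conj; reflexivity).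
  assert (T0 : t 0%C = 0%C).
  { apply Hu; [apply Ht, unit_disc_0|apply unit_disc_0|].
    rewrite (proj2 (Ht 0%C unit_disc_0)), C0. now apply Real_conj. }
  assert (Hd0 : C_derive psi 0 <> 0%C) by now apply univalent_derive_neq_0, unit_disc_0.
  assert (Hd1 : C_derive t 0 = 1%C).
  { assert (E : C_derive (fun z => psi (t z)) 0 = C_derive psi 0).
    { rewrite (C_derive_ext _ (fun z => Cconj (psi (Cconj z))) 0 1).
      - rewrite C_derive_conj by (rewrite C0; apply Hs, unit_disc_0).
        rewrite C0. now apply Real_conj.
      - lra.
      - intros z Hz. rewrite Cminus_0_r in Hz. now apply Ht.
      - apply (smooth_comp psi t); [rewrite T0|]; auto using unit_disc_0. }
    rewrite C_derive_comp in E; [|rewrite T0; apply Hs, unit_disc_0|apply St, unit_disc_0].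
    rewrite T0 in E. set (a := C_derive psi 0) in *.
    replace (C_derive t 0) with (/ a * (a * C_derive t 0))%C by (field; auto).
    rewrite E. field. auto. }
  assert (Tid : forall z, unit_disc z -> t z = z).
  { apply conj_involution_identity; auto.
    - intros z Hz. now apply Ht.
    - intros z Hz. destruct (Ht z Hz) as [Hz1 E1].
      destruct (Ht (Cconj (t z)) (unit_disc_conj _ Hz1)) as [Hz2 E2].
      apply Hu; auto using unit_disc_conj.
      rewrite Cconj_conj, E1, Cconj_conj in E2.
      assert (E3 : t (Cconj (t z)) = Cconj z).
      { apply Hu; auto using unit_disc_conj. }
      now rewrite E3, Cconj_conj.
    - rewrite Hd1. simpl. lra.
    - rewrite Hd1. reflexivity. }
  intros z Hz. destruct (Ht (Cconj z) (unit_disc_conj z Hz)) as [_ E].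
  rewrite Tid in E by now apply unit_disc_conj. now rewrite Cconj_conj in E.
Qed.

(** * Monotonicity on the real axis *)

Lemma is_derive_continuity_pt (f : R -> R) (x l : R) : is_derive f x l -> continuity_pt f x.
Proof.
  intros H. apply derivable_continuous_pt. exists l. now apply is_derive_Reals.
Qed.

(** The pair [(x, y)] with [x < y] is joined to [(0, eta)] by a segment of such
    pairs, along which [psi y - psi x] cannot vanish by injectivity; for
    small [eta] the sign is that of [psi' 0]. *)
Lemma univalent_real_increasing (psi : C -> C) :
  smooth_on_disc psi -> univalent_on_disc psi ->
  (forall x, -1 < x < 1 -> Im (psi (RtoC x)) = 0) ->
  0 < Re (C_derive psi 0) ->
  forall x y, -1 < x -> x <= y -> y < 1 -> Re (psi (RtoC x)) <= Re (psi (RtoC y)).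
Proof.
  intros Hs Hu Hre Hd x y Hx Hxy Hy.
  assert (Hin : forall u, -1 < u < 1 -> unit_disc (RtoC u)).
  { intros u Hu'. unfold unit_disc. rewrite Cmod_R. now apply Rabs_def1. }
  assert (Hneq : forall u v, -1 < u -> u < v -> v < 1 -> Re (psi (RtoC u)) <> Re (psi (RtoC v))).
  { intros u v Hu1 Huv Hv E. assert (E2 : RtoC u = RtoC v).
    { apply Hu; [apply Hin; lra|apply Hin; lra|].
      apply injective_projections; [exact E|].
      change (Im (psi (RtoC u)) = Im (psi (RtoC v))). rewrite !Hre by lra. reflexivity. }
    apply RtoC_inj in E2. lra. }
  assert (Hder : forall a b s, -1 < a + s * b < 1 ->
    is_derive (fun s => Re (psi (RtoC (a + s * b)))) s (Re (RtoC b * C_derive psi (RtoC (a + s * b)))%C)).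
  { intros a b s Hsab.
    assert (E : forall s, RtoC (a + s * b) = (RtoC a + RtoC s * RtoC b)%C).
    { intros s'. now rewrite RtoC_plus, RtoC_mult. }
    apply is_derive_ext with (fun s => Re (psi (RtoC a + RtoC s * RtoC b)%C)).
    { intros t. now rewrite E. }
    rewrite E.
    apply (curve_derive_comp psi (fun s => RtoC a + RtoC s * RtoC b)%C s (RtoC b)).
    - rewrite <- E. now apply Hs, Hin.
    - apply curve_derive_line. }
  assert (Hinc : exists eta, 0 < eta < 1 /\ Re (psi (RtoC 0)) < Re (psi (RtoC eta))).
  { pose proof (Hder 0 1 0 ltac:(lra)) as H0. replace (0 + 0 * 1) with 0 in H0 by ring.
    apply is_derive_Reals in H0.
    replace (Re (RtoC 1 * C_derive psi (RtoC 0))%C) with (Re (C_derive psi (RtoC 0))) in H0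
      by (f_equal; ring).
    destruct (H0 _ Hd) as [d H1]. pose (eta := Rmin (d / 2) (1 / 2)).
    pose proof (cond_pos d).
    assert (0 < eta) by (unfold eta; apply Rmin_glb_lt; lra).
    assert (eta <= d / 2) by apply Rmin_l. assert (eta <= 1 / 2) by apply Rmin_r.
    exists eta. split; [lra|].
    specialize (H1 eta ltac:(lra)). rewrite Rabs_pos_eq in H1 by lra. specialize (H1 ltac:(lra)).
    replace (0 + (0 + eta) * 1) with eta in H1 by ring.
    replace (0 + 0 * 1) with 0 in H1 by ring.
    apply Rabs_def2 in H1.
    set (X := Re (psi (RtoC eta)) - Re (psi (RtoC 0))) in *.
    assert (0 < X / eta) by lra.
    assert (0 < X). { replace X with (X / eta * eta) by (field; lra). apply Rmult_lt_0_compat; lra. }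
    unfold X in *. lra. }
  destruct Hxy as [Hxy|<-]; [|lra].
  destruct (Rle_lt_dec (Re (psi (RtoC x))) (Re (psi (RtoC y)))) as [|Hlt]; [assumption|exfalso].
  destruct Hinc as [eta [He1 He2]].
  (* The segment from the pair (0, eta) to the pair (x, y). *)
  assert (B : forall s, 0 <= s <= 1 -> -1 < 0 + s * x /\ 0 + s * x < eta + s * (y - eta) /\
    eta + s * (y - eta) < 1).
  { intros s Hs'. assert (s = 0 \/ 0 < s) as [->|Hp] by lra; [lra|].
    repeat split; nra. }
  destruct (Ranalysis5.IVT_interv (fun s => Re (psi (RtoC (0 + s * x))) - Re (psi (RtoC (eta + s * (y - eta))))) 0 1)
    as [s [Hs1 Hs2]].
  - intros s Hs'. destruct (B s Hs') as [B1 [B2 B3]].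
    apply continuity_pt_minus; eapply is_derive_continuity_pt; apply Hder; lra.
  - lra.
  - replace (0 + 0 * x) with 0 by ring. replace (eta + 0 * (y - eta)) with eta by ring. lra.
  - replace (0 + 1 * x) with x by ring. replace (eta + 1 * (y - eta)) with y by ring. lra.
  - destruct (B s Hs1) as [B1 [B2 B3]]. apply (Hneq _ _ B1 B2 B3). lra.
Qed.

(** * Growth along radii *)

Lemma is_derive_ln_Cmod (gamma : R -> C) (t : R) (v : C) :
  curve_derive gamma t v -> gamma t <> 0%C ->
  is_derive (fun s => ln (Cmod (gamma s))) t (Re (v / gamma t)%C).
Proof.
  intros [HR HI] H0.
  assert (Hp : 0 < Re (gamma t) ^ 2 + Im (gamma t) ^ 2).
  { rewrite <- Cmod2_alt. apply pow_lt. now apply Cmod_gt_0. }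
  assert (D : forall (X Y : R -> R) (a b : R), is_derive X t a -> is_derive Y t b ->
    0 < X t ^ 2 + Y t ^ 2 ->
    is_derive (fun s => ln (sqrt (X s ^ 2 + Y s ^ 2))) t ((a * X t + b * Y t) / (X t ^ 2 + Y t ^ 2))).
  { intros X Y a b HX HY HS. auto_derive.
    - simpl in HS. repeat split; [now exists a|now exists b|lra|apply sqrt_lt_R0; lra].
    - assert (EX : Derive (fun x : R => X x) t = a) by exact (is_derive_unique X t a HX).
      assert (EY : Derive (fun x : R => Y x) t = b) by exact (is_derive_unique Y t b HY).
      rewrite EX, EY.
      replace (X t * (X t * 1) + Y t * (Y t * 1)) with (X t ^ 2 + Y t ^ 2) by ring.
      set (S := X t ^ 2 + Y t ^ 2) in *.
      rewrite <- (sqrt_sqrt S) at 3 by lra.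
      assert (0 < sqrt S) by now apply sqrt_lt_R0. field. lra. }
  replace (Re (v / gamma t)%C) with
    ((Re v * Re (gamma t) + Im v * Im (gamma t)) / (Re (gamma t) ^ 2 + Im (gamma t) ^ 2)).
  - apply (D (fun s => Re (gamma s)) (fun s => Im (gamma s))); auto.
  - destruct (gamma t) as [a b], v as [c d]. simpl in *. field. lra.
Qed.

Lemma is_derive_left_max (f : R -> R) (l : R) :
  is_derive f 0 l -> (forall t, -1 <= t <= 0 -> f t <= f 0) -> 0 <= l.
Proof.
  intros H Hm. apply is_derive_Reals in H.
  destruct (Rle_lt_dec 0 l) as [|Hl]; [assumption|exfalso].
  destruct (H (- l) ltac:(lra)) as [d Hd]. pose proof (cond_pos d).
  pose (h := Rmin (d / 2) 1). assert (0 < h) by (apply Rmin_glb_lt; lra).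
  assert (h <= d / 2) by apply Rmin_l. assert (h <= 1) by apply Rmin_r.
  specialize (Hd (- h) ltac:(lra)). rewrite Rabs_Ropp, Rabs_pos_eq in Hd by lra.
  specialize (Hd ltac:(lra)). rewrite Rplus_0_l in Hd. specialize (Hm (- h) ltac:(lra)).
  apply Rabs_def2 in Hd.
  assert (0 <= (f (- h) - f 0) / - h).
  { replace ((f (- h) - f 0) / - h) with ((f 0 - f (- h)) / h) by (field; lra).
    apply Rdiv_le_0_compat; lra. }
  lra.
Qed.

Lemma curve_derive_rotation (m : C) :
  curve_derive (fun t => m * (cos t, sin t))%C 0 (m * Ci)%C.
Proof.
  destruct m as [a b]. split; simpl.
  - auto_derive; [exact I|]. rewrite sin_0, cos_0. ring.
  - auto_derive; [exact I|]. rewrite sin_0, cos_0. ring.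
Qed.

Lemma Cmod_cos_sin (t : R) : Cmod (cos t, sin t) = 1.
Proof.
  unfold Cmod. simpl fst. simpl snd. pose proof (sin2_cos2 t) as H. unfold Rsqr in H.
  replace (cos t ^ 2 + sin t ^ 2) with 1 by (simpl; lra). apply sqrt_1.
Qed.

Lemma continuity_pt_eps (f : R -> R) (x e : R) :
  continuity_pt f x -> 0 < e ->
  exists d, 0 < d /\ forall y, Rabs (y - x) < d -> Rabs (f y - f x) < e.
Proof.
  intros H He. destruct (H e He) as [d [Hd H1]]. exists d. split; [exact Hd|].
  intros y Hy. destruct (Req_dec y x) as [->|Hne].
  - rewrite Rminus_diag, Rabs_R0. exact He.
  - apply (H1 y). split; [|exact Hy]. split; [exact I|]. congruence.
Qed.

(** At a maximum [m <> 0] of [ln |F z| - K |z| - e |z|] over the disc, the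
    derivative in the angular direction shows that [z F' / F] is real; the
    hypothesis then makes the radial derivative at most [- e], although at a
    maximum over a disc it cannot be negative in the outward direction.  So the
    maximum is at [0]. *)
Lemma radial_growth (F : C -> C) (K k : R -> R) (r : R) :
  0 < r -> (forall z, Cmod z <= r -> smooth_at F z) ->
  (forall z, Cmod z <= r -> F z <> 0%C) -> F 0%C = 1%C -> K 0 = 0 ->
  (forall s, 0 <= s <= r -> is_derive K s (k s)) ->
  (forall z : C, z <> 0%C -> Cmod z <= r -> Im (z * C_derive F z / F z)%C = 0 ->
     Re (z * C_derive F z / F z)%C <= Cmod z * k (Cmod z)) ->
  forall z, Cmod z <= r -> ln (Cmod (F z)) <= K (Cmod z).
Proof.
  intros Hr HF HF0 F0 K0 HK Hreal z Hz.
  apply le_of_small_penalty with (Cmod z). intros e He.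
  pose (G := fun z => ln (Cmod (F z)) - K (Cmod z) - e * Cmod z).
  enough (G z <= 0) by (unfold G in *; lra).
  destruct (compact_max (fun z => Cmod z <= r) G r 0%C) as [m [Hm Hmax]].
  - rewrite Cmod_0. lra.
  - auto.
  - intros y Hy. destruct (disc_complement_open 0 r y) as [d [Hd H]].
    + now rewrite Cminus_0_r.
    + exists d. split; [exact Hd|]. intros x Hx. rewrite <- (Cminus_0_r x). now apply H.
  - intros y Hy e' He'. pose proof (Cmod_ge_0 y) as Hy0.
    assert (Hpos : 0 < Cmod (F y)) by now apply Cmod_gt_0, HF0.
    destruct (continuity_pt_eps ln (Cmod (F y)) (e' / 3)) as [d1 [Hd1 H1]]; [|lra|].
    { eapply is_derive_continuity_pt. apply is_derive_Reals. now apply derivable_pt_lim_ln. }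
    destruct (Cmod_continuous F y (smooth_continuous _ _ (HF y Hy)) d1 Hd1) as [d2 [Hd2 H2]].
    destruct (continuity_pt_eps K (Cmod y) (e' / 3)) as [d3 [Hd3 H3]]; [|lra|].
    { eapply is_derive_continuity_pt. apply HK. lra. }
    assert (Hd4 : 0 < e' / (3 * e)) by (apply Rdiv_lt_0_compat; lra).
    exists (Rmin (Rmin d2 d3) (e' / (3 * e))). split; [repeat apply Rmin_glb_lt; auto|].
    intros x Hx Hxy.
    pose proof (Rmin_l (Rmin d2 d3) (e' / (3 * e))). pose proof (Rmin_r (Rmin d2 d3) (e' / (3 * e))).
    pose proof (Rmin_l d2 d3). pose proof (Rmin_r d2 d3).
    pose proof (Cmod_sub_ge x y) as A1. pose proof (Cmod_sub_ge y x) as A2.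
    rewrite (Cmod_sub_sym y x) in A2.
    specialize (H1 (Cmod (F x)) (H2 x ltac:(lra))). specialize (H3 (Cmod x)).
    assert (H3' : Rabs (Cmod x - Cmod y) < d3) by (apply Rabs_def1; lra).
    specialize (H3 H3'). apply Rabs_def2 in H1. apply Rabs_def2 in H3.
    assert (e * (Cmod y - Cmod x) < e' / 3).
    { replace (e' / 3) with (e * (e' / (3 * e))) by (field; lra).
      apply Rmult_lt_compat_l; lra. }
    unfold G. lra.
  - apply Rle_trans with (G m); [now apply Hmax|].
    destruct (Ceq_dec m 0) as [->|Hm0].
    { unfold G. rewrite F0, Cmod_0, Cmod_1, ln_1, K0. lra. }
    exfalso. apply Cmod_gt_0 in Hm0 as Hmp.
    assert (HFm := HF m Hm). assert (HFm0 := HF0 m Hm).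
    set (q := (m * C_derive F m / F m)%C).
    (* Rotating m in both senses keeps |z|, so only ln |F| varies. *)
    assert (Himq : Im q = 0).
    { assert (E0 : (m * (cos 0, sin 0))%C = m).
      { rewrite cos_0, sin_0. change (1, 0) with (RtoC 1). ring. }
      assert (D : is_derive (fun t => ln (Cmod (F (m * (cos t, sin t))%C))) 0 (- Im q)).
      { replace (- Im q) with (Re ((m * Ci * C_derive F (m * (cos 0, sin 0))) / F (m * (cos 0, sin 0)))%C).
        - apply (is_derive_ln_Cmod (fun t => F (m * (cos t, sin t))%C)).
          + apply (curve_derive_comp F (fun t => m * (cos t, sin t))%C).
            * now rewrite E0.
            * apply curve_derive_rotation.
          + now rewrite E0.
        - rewrite E0. unfold q.
          replace (m * Ci * C_derive F m / F m)%C with (Ci * (m * C_derive F m / F m))%C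
            by (field; auto).
          destruct (m * C_derive F m / F m)%C as [a b]. simpl. ring. }
      assert (M : forall t, ln (Cmod (F (m * (cos t, sin t))%C)) <= ln (Cmod (F (m * (cos 0, sin 0))%C))).
      { intros t. rewrite E0. pose proof (Hmax (m * (cos t, sin t))%C) as H.
        unfold G in H. rewrite Cmod_mult, Cmod_cos_sin, Rmult_1_r in H. specialize (H Hm). lra. }
      assert (0 <= - Im q).
      { apply (is_derive_left_max _ _ D). intros t _. apply M. }
      assert (0 <= Im q).
      { apply (is_derive_left_max (fun t => ln (Cmod (F (m * (cos (- t), sin (- t)))%C)))).
        - replace (Im q) with (scal (-1) (- Im q)) by (unfold scal; simpl; unfold mult; simpl; ring).
          apply (is_derive_comp (fun t => ln (Cmod (F (m * (cos t, sin t))%C))) (fun t => - t)).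
          + rewrite Ropp_0. exact D.
          + auto_derive; [exact I|ring].
        - intros t _. rewrite Ropp_0. apply M. }
      lra. }
    specialize (Hreal m Hm0 Hm Himq). fold q in Hreal.
    (* On the segment from 0 to m the function G has its maximum at the end m. *)
    assert (D : is_derive (fun t => G (m + RtoC t * m)%C) 0 (Re q - Cmod m * k (Cmod m) - e * Cmod m)).
    { assert (E0 : (m + RtoC 0 * m)%C = m) by ring.
      apply is_derive_ext_loc with
        (fun t => ln (Cmod (F (m + RtoC t * m)%C)) - K (Cmod m + t * Cmod m) - e * (Cmod m + t * Cmod m)).
      { exists (mkposreal 1 Rlt_0_1). intros t Ht.
        unfold ball in Ht. simpl in Ht. unfold AbsRing_ball in Ht.
        change (Rabs (t - 0) < 1) in Ht. apply Rabs_def2 in Ht.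
        assert (E : Cmod (m + RtoC t * m) = Cmod m + t * Cmod m).
        { replace (m + RtoC t * m)%C with (RtoC (1 + t) * m)%C by (rewrite RtoC_plus; ring).
          rewrite Cmod_mult, Cmod_R, Rabs_pos_eq by lra. ring. }
        unfold G. now rewrite E. }
      assert (D1 : is_derive (fun t => ln (Cmod (F (m + RtoC t * m)%C))) 0 (Re q)).
      { unfold q. rewrite <- E0 at 2 3.
        apply (is_derive_ln_Cmod (fun t => F (m + RtoC t * m)%C)).
        - apply (curve_derive_comp F (fun t => m + RtoC t * m)%C).
          + now rewrite E0.
          + apply curve_derive_line.
        - now rewrite E0. }
      assert (D2 : is_derive (fun t => K (Cmod m + t * Cmod m)) 0 (Cmod m * k (Cmod m))).
      { change (Cmod m * k (Cmod m)) with (scal (Cmod m) (k (Cmod m))).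
        apply (is_derive_comp K (fun t => Cmod m + t * Cmod m)).
        - rewrite Rmult_0_l, Rplus_0_r. apply HK. lra.
        - auto_derive; [exact I|ring]. }
      apply (is_derive_minus (fun t => ln (Cmod (F (m + RtoC t * m)%C)) - K (Cmod m + t * Cmod m))
               (fun t => e * (Cmod m + t * Cmod m))).
      - now apply (is_derive_minus (fun t => ln (Cmod (F (m + RtoC t * m)%C)))).
      - auto_derive; [exact I|ring]. }
    apply is_derive_left_max in D.
    + assert (0 < e * Cmod m) by (apply Rmult_lt_0_compat; lra). lra.
    + intros t Ht. replace (m + RtoC 0 * m)%C with m by ring. apply Hmax.
      replace (m + RtoC t * m)%C with (RtoC (1 + t) * m)%C by (rewrite RtoC_plus; ring).
      rewrite Cmod_mult, Cmod_R, Rabs_pos_eq by lra. nra.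
Qed.

(** * The growth estimate for starlike functions *)

Lemma C_derive_id_mult (F : C -> C) (z : C) :
  smooth_at F z -> C_derive (fun y => y * F y)%C z = (F z + z * C_derive F z)%C.
Proof.
  intros HF. rewrite <- (slope_diag F).
  apply (C_derive_of_slope _ (fun y => F y + z * slope F z y)%C z 1); [lra| |].
  - intros y _. rewrite (slope_eq F z y). ring.
  - apply smooth_continuous, smooth_plus; auto.
    apply smooth_mult; [apply smooth_const|now apply smooth_slope].
Qed.

Lemma C_derive_inv (F : C -> C) (z : C) :
  smooth_at F z -> F z <> 0%C -> C_derive (fun y => / F y)%C z = (- C_derive F z / (F z * F z))%C.
Proof.
  intros HF H0. rewrite <- (slope_diag F).
  destruct (continuous_away_from_0 F z (smooth_continuous _ _ HF) H0) as [d [Hd H]].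
  replace (- slope F z z / (F z * F z))%C with (- / F z * (slope F z z * / F z))%C by (field; auto).
  apply (C_derive_of_slope _ (fun y => - / F z * (slope F z y * / F y))%C z d); [exact Hd| |].
  - intros y Hy. assert (Hy0 : F y <> 0%C).
    { apply Cmod_gt_0. apply Cmod_gt_0 in H0. specialize (H y Hy). lra. }
    replace (/ F z + (y - z) * (- / F z * (slope F z y * / F y)))%C
      with (/ F z - / F z * / F y * ((F z + (y - z) * slope F z y) - F z))%C by ring.
    rewrite <- (slope_eq F z y). field. auto.
  - apply smooth_continuous, smooth_mult; [apply smooth_const|].
    apply smooth_mult; [now apply smooth_slope|now apply smooth_inv].
Qed.

(** Division by zero gives zero; a zero of [f] outside the origin would thus
    give the value [0] to [z f' / f], which [Re psi > 0] excludes. *)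
Lemma Cinv_0 : (/ 0)%C = 0%C.
Proof. apply injective_projections; simpl; unfold Rdiv; ring. Qed.

(** The exponent in [f_0] on the real axis.  The slope of [psi] at [0] is
    [(psi t - 1) / t] with its singularity at [0] removed. *)
Definition log_growth (psi : C -> C) (x : R) : R :=
  RInt (fun t => Re (slope psi 0 (RtoC t))) 0 x.

Lemma slope_real_continuous (psi : C -> C) (t : R) :
  smooth_on_disc psi -> -1 < t < 1 -> continuous (fun t => Re (slope psi 0 (RtoC t))) t.
Proof.
  intros Hs Ht.
  assert (Hd : unit_disc (RtoC t)) by (unfold unit_disc; rewrite Cmod_R; now apply Rabs_def1).
  assert (D : curve_derive (fun s => 0 + RtoC s * 1)%C t 1%C) by apply curve_derive_line.
  apply (curve_derive_comp (slope psi 0)) in D.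
  - apply (ex_derive_continuous (K := R_AbsRing) (V := R_NormedModule)).
    eexists. eapply is_derive_ext; [|exact (proj1 D)].
    intros s. simpl. f_equal. f_equal. ring.
  - replace (0 + RtoC t * 1)%C with (RtoC t) by ring.
    apply smooth_slope; apply Hs; auto using unit_disc_0.
Qed.

Lemma log_growth_ex_RInt (psi : C -> C) (x : R) :
  smooth_on_disc psi -> -1 < x < 1 ->
  ex_RInt (fun t => Re (slope psi 0 (RtoC t))) 0 x.
Proof.
  intros Hs Hx. apply (ex_RInt_continuous (V := R_CompleteNormedModule)).
  intros t Ht. apply slope_real_continuous; auto.
  revert Ht. unfold Rmin, Rmax. destruct (Rle_dec 0 x); lra.
Qed.

Lemma log_growth_derive (psi : C -> C) (x : R) :
  smooth_on_disc psi -> -1 < x < 1 ->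
  is_derive (log_growth psi) x (Re (slope psi 0 (RtoC x))).
Proof.
  intros Hs Hx. apply (is_derive_RInt (V := R_NormedModule) (fun t => Re (slope psi 0 (RtoC t))) _ 0).
  - assert (Hp : 0 < Rmin (x + 1) (1 - x)) by (apply Rmin_glb_lt; lra).
    exists (mkposreal _ Hp). intros y Hy. change (Rabs (y - x) < Rmin (x + 1) (1 - x)) in Hy.
    pose proof (Rmin_l (x + 1) (1 - x)). pose proof (Rmin_r (x + 1) (1 - x)).
    apply Rabs_def2 in Hy.
    apply (RInt_correct (V := R_CompleteNormedModule)). apply log_growth_ex_RInt; auto; lra.
  - now apply slope_real_continuous.
Qed.

(** On the real axis the integrand is real, and its substitution [t = s x]
    brings it to the integral from [0] to [x]. *)
Lemma f_0_real (psi : C -> C) (x : R) :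
  smooth_on_disc psi -> psi 0%C = 1%C ->
  (forall t, -1 < t < 1 -> Im (psi (RtoC t)) = 0) ->
  -1 < x < 1 -> x <> 0 ->
  f_0 psi (RtoC x) = RtoC (x * exp (log_growth psi x)).
Proof.
  intros Hs H0 Hre Hx Hx0.
  assert (HI : is_RInt (V := C_R_NormedModule)
    (fun s : R => (RtoC x * ((psi (RtoC s * RtoC x) - 1) / (RtoC s * RtoC x)))%C) 0 1
    (log_growth psi x, 0)).
  { apply (is_RInt_ext (V := C_R_NormedModule)
      (fun s => (x * Re (slope psi 0 (RtoC (x * s + 0))), 0))).
    { intros s Hs'. rewrite Rmin_left, Rmax_right in Hs' by lra.
      assert (Hsx : -1 < s * x < 1) by (split; nra).
      assert (Hsx0 : RtoC (s * x) <> 0%C).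
      { intros E. apply RtoC_inj in E. nra. }
      replace (x * s + 0) with (s * x) by ring. rewrite <- RtoC_mult.
      rewrite slope_off by exact Hsx0. rewrite H0, Cminus_0_r.
      pose proof (Hre _ Hsx) as Him. destruct (psi (RtoC (s * x))) as [a b]. simpl in Him. subst b.
      change (a, 0) with (RtoC a).
      rewrite <- RtoC_minus, <- RtoC_div, <- RtoC_mult by (intros E; apply Hsx0; now rewrite E).
      reflexivity. }
    apply (is_RInt_fct_extend_pair (U := R_NormedModule) (V := R_NormedModule)).
    - apply (is_RInt_comp_lin (V := R_NormedModule) (fun t => Re (slope psi 0 (RtoC t))) x 0 0 1).
      replace (x * 0 + 0) with 0 by ring. replace (x * 1 + 0) with x by ring.
      apply (RInt_correct (V := R_CompleteNormedModule)). now apply log_growth_ex_RInt.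
    - simpl. pose proof (is_RInt_const (V := R_NormedModule) 0 1 0) as H.
      change (is_RInt (V := R_NormedModule) (fun _ : R => 0) 0 1 ((1 - 0) * 0)) in H.
      rewrite Rmult_0_r in H. exact H. }
  unfold f_0, C_segment_integral.
  rewrite (is_RInt_unique (V := C_R_CompleteNormedModule) _ _ _ _ HI).
  unfold Cexp. simpl. rewrite cos_0, sin_0.
  apply injective_projections; simpl; ring.
Qed.

(** If [psi z] is real, then [psi (conj z) = psi z], and injectivity makes [z]
    real. *)
Lemma ma_minda_real_axis (psi : C -> C) :
  ma_minda psi ->
  smooth_on_disc psi /\
  (forall x, -1 < x < 1 -> Im (psi (RtoC x)) = 0) /\
  (forall z, unit_disc z -> Im (psi z) = 0 -> Im z = 0) /\
  (forall x y, -1 < x -> x <= y -> y < 1 -> Re (psi (RtoC x)) <= Re (psi (RtoC y))).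
Proof.
  intros [Ha [Hu [_ [H1 [[HI HR] Hsym]]]]].
  assert (Hs : smooth_on_disc psi) by (intros z Hz; now apply analytic_smooth).
  assert (Hc : forall z, unit_disc z -> psi (Cconj z) = Cconj (psi z)).
  { apply conj_symmetric; auto. now rewrite H1. }
  assert (Hre : forall x, -1 < x < 1 -> Im (psi (RtoC x)) = 0).
  { intros x Hx. assert (Hd : unit_disc (RtoC x)).
    { unfold unit_disc. rewrite Cmod_R. now apply Rabs_def1. }
    specialize (Hc _ Hd). replace (Cconj (RtoC x)) with (RtoC x) in Hc
      by (unfold Cconj, RtoC; simpl; f_equal; ring).
    apply (f_equal Im) in Hc. destruct (psi (RtoC x)) as [a b]. simpl in *. lra. }
  repeat split; auto.
  - intros z Hz Hi. assert (E : Cconj z = z).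
    { apply Hu; auto using unit_disc_conj. rewrite Hc by exact Hz.
      destruct (psi z) as [a b]. simpl in Hi. subst b. unfold Cconj; simpl. f_equal. ring. }
    apply (f_equal Im) in E. destruct z as [a b]. simpl in *. lra.
  - now apply univalent_real_increasing.
Qed.

(** When [z F' / F = psi (w z) - 1] is real, [w z] is a real number of modulus at
    most [|z|], and monotonicity of [psi] on the real axis gives the hypotheses
    of [radial_growth] for [F] and for [1 / F]. *)
Lemma starlike_growth (psi f : C -> C) :
  ma_minda psi -> S_star psi f ->
  forall z : C, z <> 0%C -> unit_disc z ->
    Cmod z * exp (log_growth psi (- Cmod z)) <= Cmod (f z) <=
    Cmod z * exp (log_growth psi (Cmod z)).
Proof.
  intros Hpsi Hf z Hz0 Hz.
  destruct (ma_minda_real_axis psi Hpsi) as [Hs [Hre [Hreal Hinc]]].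
  destruct Hpsi as [_ [_ [Hpos [H1 _]]]].
  destruct Hf as [[Hfa [a [Ha0 [Ha1 Hfs]]]] [_ [_ [w [Hwa [Hw0 [Hwd Hw]]]]]]].
  assert (Hfs' : forall y, Cmod (y - 0) < 1 -> is_Cpseries a (y - 0)%C (f y)).
  { intros y Hy. rewrite Cminus_0_r in *. now apply Hfs. }
  assert (Sf : smooth_on_disc f) by (intros y Hy; now apply analytic_smooth).
  assert (f0 : f 0%C = 0%C).
  { exact (eq_trans (proj1 (pseries_slope a f 0 1 Rlt_0_1 Hfs')) Ha0). }
  pose (F := slope f 0).
  assert (SF : smooth_on_disc F).
  { intros y Hy. apply smooth_slope; apply Sf; auto using unit_disc_0. }
  assert (fF : forall y, f y = (y * F y)%C).
  { intros y. rewrite (slope_eq f 0 y). fold F. rewrite f0. ring. }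
  assert (F0 : F 0%C = 1%C).
  { unfold F. rewrite slope_diag. exact (eq_trans (pseries_derive a f 0 1 Rlt_0_1 Hfs') Ha1). }
  assert (fn0 : forall y : C, y <> 0%C -> unit_disc y -> f y <> 0%C).
  { intros y Hy0 Hy E. specialize (Hw y Hy). unfold starlike_quotient in Hw.
    destruct (Ceq_dec y 0); [contradiction|].
    rewrite E in Hw. unfold Cdiv in Hw. rewrite Cinv_0 in Hw.
    specialize (Hpos (w y) (Hwd y Hy)). rewrite <- Hw in Hpos.
    replace (y * C_derive f y * 0)%C with (RtoC 0) in Hpos by ring. simpl in Hpos. lra. }
  assert (Fn0 : forall y, unit_disc y -> F y <> 0%C).
  { intros y Hy E. destruct (Ceq_dec y 0) as [->|Hy0].
    - rewrite F0 in E. apply RtoC_inj in E. lra.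
    - apply (fn0 y Hy0 Hy). rewrite fF, E. ring. }
  assert (Hq : forall y : C, y <> 0%C -> unit_disc y -> (y * C_derive F y / F y = psi (w y) - 1)%C).
  { intros y Hy0 Hy. rewrite <- Hw by exact Hy. unfold starlike_quotient.
    destruct (Ceq_dec y 0); [contradiction|].
    rewrite (C_derive_ext f (fun y => y * F y)%C y 1), C_derive_id_mult, fF; auto; [|lra].
    field. split; auto. }
  assert (Hw_le : forall y, unit_disc y -> Cmod (w y) <= Cmod y).
  { apply schwarz; auto. intros y Hy. now apply analytic_smooth. }
  assert (Hbound : forall y : C, y <> 0%C -> unit_disc y -> Im (y * C_derive F y / F y)%C = 0 ->
    Re (psi (RtoC (- Cmod y))) - 1 <= Re (y * C_derive F y / F y)%C <= Re (psi (RtoC (Cmod y))) - 1).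
  { intros y Hy0 Hy Him. rewrite Hq in * by auto.
    assert (Hwi : Im (w y) = 0).
    { apply Hreal; [now apply Hwd|]. destruct (psi (w y)) as [u v]. simpl in *. lra. }
    assert (Ew : w y = RtoC (Re (w y))) by (apply injective_projections; [reflexivity|exact Hwi]).
    pose proof (Hw_le y Hy) as Hle. rewrite Ew, Cmod_R in Hle. apply Rabs_le_between in Hle.
    unfold unit_disc in Hy.
    assert (Er : Re (psi (w y) - 1)%C = Re (psi (w y)) - 1) by (destruct (psi (w y)); reflexivity).
    rewrite Er, Ew.
    pose proof (Hinc (- Cmod y) (Re (w y)) ltac:(lra) ltac:(lra) ltac:(lra)).
    pose proof (Hinc (Re (w y)) (Cmod y) ltac:(lra) ltac:(lra) ltac:(lra)). lra. }
  assert (Hk : forall x, -1 < x < 1 -> x <> 0 -> x * Re (slope psi 0 (RtoC x)) = Re (psi (RtoC x)) - 1).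
  { intros x Hx Hx0. pose proof (slope_eq psi 0 (RtoC x)) as E. rewrite H1, Cminus_0_r in E.
    rewrite E. destruct (slope psi 0 (RtoC x)) as [u v]. simpl. ring. }
  assert (Hr : 0 < Cmod z) by now apply Cmod_gt_0.
  assert (L0 : log_growth psi 0 = 0) by apply (RInt_point (V := R_CompleteNormedModule)).
  unfold unit_disc in Hz.
  assert (HFz : 0 < Cmod (F z)) by now apply Cmod_gt_0, Fn0.
  assert (Upper : ln (Cmod (F z)) <= log_growth psi (Cmod z)).
  { apply (radial_growth F (log_growth psi) (fun s => Re (slope psi 0 (RtoC s))) (Cmod z)); auto; try lra.
    - intros y Hy. apply SF. unfold unit_disc; lra.
    - intros y Hy. apply Fn0. unfold unit_disc; lra.
    - intros s Hs'. apply log_growth_derive; auto; lra.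
    - intros y Hy0 Hy Him. assert (0 < Cmod y) by now apply Cmod_gt_0.
      rewrite Hk by lra. apply Hbound; auto. unfold unit_disc; lra. }
  assert (Lower : ln (Cmod (/ F z)) <= - log_growth psi (- Cmod z)).
  { apply (radial_growth (fun y => / F y)%C (fun s => - log_growth psi (- s))
             (fun s => Re (slope psi 0 (RtoC (- s)))) (Cmod z)); auto; try lra.
    - intros y Hy. apply smooth_inv; [apply SF|apply Fn0]; unfold unit_disc; lra.
    - intros y Hy E. apply (C1_nz). assert (Fy : F y <> 0%C) by (apply Fn0; unfold unit_disc; lra).
      replace (RtoC 1) with (F y * / F y)%C by (field; auto). rewrite E. ring.
    - rewrite F0. field. 
    - rewrite Ropp_0, L0. ring.
    - intros s Hs'.
      replace (Re (slope psi 0 (RtoC (- s)))) with (opp (scal (-1) (Re (slope psi 0 (RtoC (- s))))))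
        by (unfold opp, scal; simpl; unfold mult; simpl; ring).
      apply (is_derive_opp (fun s => log_growth psi (- s))).
      apply (is_derive_comp (log_growth psi) Ropp).
      + apply log_growth_derive; auto; lra.
      + auto_derive; [exact I|ring].
    - intros y Hy0 Hy. assert (0 < Cmod y) by now apply Cmod_gt_0.
      assert (Hyd : unit_disc y) by (unfold unit_disc; lra).
      rewrite C_derive_inv by auto.
      replace (y * (- C_derive F y / (F y * F y)) / / F y)%C with (- (y * C_derive F y / F y))%C
        by (field; auto).
      intros Him. assert (Him' : Im (y * C_derive F y / F y)%C = 0).
      { destruct (y * C_derive F y / F y)%C as [u v]. simpl in *. lra. }
      pose proof (Hbound y Hy0 Hyd Him') as HB.
      replace (Re (- (y * C_derive F y / F y))%C) with (- Re (y * C_derive F y / F y)%C)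
        by (destruct (y * C_derive F y / F y)%C; reflexivity).
      pose proof (Hk (- Cmod y) ltac:(lra) ltac:(lra)). lra. }
  rewrite Cmod_inv, ln_Rinv in Lower by auto.
  rewrite fF, Cmod_mult. rewrite <- (exp_ln (Cmod (F z))) by exact HFz.
  assert (mono : forall u v, u <= v -> exp u <= exp v).
  { intros u v [Huv| ->]; [left; now apply exp_increasing|lra]. }
  split; apply Rmult_le_compat_l; try lra; apply mono; lra.
Qed.

(** * The bounds for the derivative *)

Theorem theorem4p1 :
  forall (psi : C -> C) (r theta1 theta2 : R) (z1 z2 : C),
    ma_minda psi ->
    0 < r < 1 ->
    0 <= theta1 <= PI ->
    0 <= theta2 <= PI ->
    z1 = (RtoC r * Cexp (Ci * RtoC theta1))%C ->
    z2 = (RtoC r * Cexp (Ci * RtoC theta2))%C ->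
    (forall z : C, Cmod z = r -> Cmod (psi z1) <= Cmod (psi z)) ->
    (forall z : C, Cmod z = r -> Cmod (psi z) <= Cmod (psi z2)) ->
    forall (f : C -> C) (z0 : C),
      S_star psi f ->
      Cmod z0 = r ->
      Cle (RtoC (Cmod (psi z1)) * (- f_0 psi (- RtoC r) / RtoC r))%C
          (RtoC (Cmod (C_derive f z0))) /\
      Cle (RtoC (Cmod (C_derive f z0)))
          ((f_0 psi (RtoC r) / RtoC r) * RtoC (Cmod (psi z2)))%C.
Proof.
  intros psi r theta1 theta2 z1 z2 Hpsi Hr _ _ _ _ Hmin Hmax f z0 Hf Hz0.
  assert (Hz0d : unit_disc z0) by (unfold unit_disc; lra).
  assert (Hz0n : z0 <> 0%C) by (intros ->; rewrite Cmod_0 in Hz0; lra).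
  destruct (starlike_growth psi f Hpsi Hf z0 Hz0n Hz0d) as [Glo Ghi]. rewrite Hz0 in Glo, Ghi.
  destruct (ma_minda_real_axis psi Hpsi) as [Hs [Hre _]].
  destruct Hpsi as [_ [_ [Hpos [H1 _]]]].
  destruct Hf as [_ [_ [_ [w [Hwa [Hw0 [Hwd Hw]]]]]]].
  assert (Hwr : Cmod (w z0 - 0) <= r).
  { rewrite Cminus_0_r, <- Hz0. apply schwarz; auto. intros y Hy. now apply analytic_smooth. }
  assert (Hsr : forall z, Cmod (z - 0) <= r -> smooth_at psi z).
  { intros z Hz. rewrite Cminus_0_r in Hz. apply Hs. unfold unit_disc; lra. }
  assert (Phi : Cmod (psi (w z0)) <= Cmod (psi z2)).
  { apply (max_modulus psi 0 r); auto; [lra|]. intros z Hz. rewrite Cminus_0_r in Hz. auto. }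
  assert (Plo : Cmod (psi z1) <= Cmod (psi (w z0))).
  { apply (min_modulus psi 0 r); auto; [lra| |].
    - intros z Hz E. rewrite Cminus_0_r in Hz. assert (Hzd : unit_disc z) by (unfold unit_disc; lra).
      specialize (Hpos z Hzd). rewrite E in Hpos. simpl in Hpos. lra.
    - intros z Hz. rewrite Cminus_0_r in Hz. auto. }
  set (E1 := exp (log_growth psi (- r))) in *. set (E2 := exp (log_growth psi r)) in *.
  assert (HE1 : 0 < E1) by apply exp_pos.
  assert (Hfz : f z0 <> 0%C).
  { apply Cmod_gt_0. eapply Rlt_le_trans; [|exact Glo]. apply Rmult_lt_0_compat; lra. }
  assert (Hf' : Cmod (C_derive f z0) * r = Cmod (psi (w z0)) * Cmod (f z0)).
  { rewrite <- Hw by exact Hz0d. unfold starlike_quotient. destruct (Ceq_dec z0 0); [contradiction|].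
    rewrite <- Cmod_mult. rewrite <- Hz0 at 1. rewrite <- Cmod_mult. f_equal. field. exact Hfz. }
  rewrite (f_0_real psi r), <- RtoC_opp, (f_0_real psi (- r)) by (auto; lra).
  fold E1 E2.
  rewrite <- RtoC_opp, <- !RtoC_div, <- !RtoC_mult by lra.
  replace (- (- r * E1) / r) with E1 by (field; lra).
  replace (r * E2 / r) with E2 by (field; lra).
  pose proof (Cmod_ge_0 (psi z1)). pose proof (Cmod_ge_0 (psi (w z0))).
  pose proof (Cmod_ge_0 (f z0)).
  split; (split; [reflexivity|split; [reflexivity|]]); simpl;
    apply Rmult_le_reg_r with r; try lra; rewrite Hf'.
  - replace (Cmod (psi z1) * E1 * r) with (Cmod (psi z1) * (r * E1)) by ring.
    apply Rmult_le_compat; auto. apply Rmult_le_pos; lra.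
  - replace (E2 * Cmod (psi z2) * r) with (Cmod (psi z2) * (r * E2)) by ring.
    apply Rmult_le_compat; auto.
Qed.
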